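(* Let $H$ be a finite dimensional Hopf algebra over a field $k$ with antipode $S$, and let $D(H)$ be its Drinfeld double. For $\sigma\in Z^2_L(H)$ define $\overline{\sigma}:D(H)\otimes D(H)\to k$ by $$\overline{\sigma}(p\otimes h,q\otimes l)=p(1)\,q(S^{-1}(h_3)h_1)\,\sigma(h_2,l),\qquad p,q\in H^*,\ h,l\in H.$$ If $\sigma\in Z^2_{PL}(H)$ then $\overline{\sigma}\in Z^2_{PL}(D(H))$. If $\sigma\in Z^2_{NL}(H)$ then $\overline{\sigma}\in Z^2_{NL}(D(H))$.
   Context: Sweedler notation $\Delta(h)=h_1\otimes h_2$ (iterated: $h_1\otimes h_2\otimes h_3$, etc.) is used. Drinfeld double: $D(H)=H^*\otimes H$ as a vector space, with coalgebra structure $H^{*cop}\otimes H$ and multiplication $$(p\otimes h)(q\otimes l)=p(h_1\rightharpoonup q\leftharpoonup S^{-1}(h_3))\otimes h_2l,$$ where $(h\rightharpoonup p)(l)=p(lh)$ and $(p\leftharpoonup h)(l)=p(hl)$ for $p\in H^*$, $h,l\in H$; the unit is $\varepsilon\otimes 1$. For a Hopf algebra $K$ with bijective antipode, $Reg^2(K)$ is the group (under convolution) of linear maps $\sigma:K\otimes K\to k$ that are convolution invertible and normalized: $\sigma(1,x)=\sigma(x,1)=\varepsilon(x)$. An element $\sigma\in Reg^2(K)$ is - lazy if $\sigma(x_1,y_1)x_2y_2=x_1y_1\sigma(x_2,y_2)$ for all $x,y\in K$; - a (left) 2-cocycle if $\sigma(a_1,b_1)\sigma(a_2b_2,c)=\sigma(b_1,c_1)\sigma(a,b_2c_2)$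 for all $a,b,c\in K$; - pure if $\sigma(ab_1,c_1)\sigma^{-1}(b_2,c_2)\sigma(b_3,c_3d)=\sigma(b_1,c_1d)\sigma^{-1}(b_2,c_2)\sigma(ab_3,c_3)$ for all $a,b,c,d\in K$, where $\sigma^{-1}$ is the convolution inverse; - neat if $\sigma(a,b_1)\sigma(b_2,c)=\sigma(b_1,c)\sigma(a,b_2)$ for all $a,b,c\in K$. $Z^2_L(K)$ is the set of lazy left 2-cocycles in $Reg^2(K)$; $Z^2_{PL}(K)$ (respectively $Z^2_{NL}(K)$) is the set of those $\sigma\in Z^2_L(K)$ that are pure (respectively neat). Known fact (cited by the paper): for $\sigma\in Z^2_L(H)$ one has $\overline{\sigma}\in Z^2_L(D(H))$, with convolution inverse $\overline{\sigma}^{-1}(p\otimes h,q\otimes l)=p(1)q(S^{-1}(h_3)h_1)\sigma^{-1}(h_2,l)$. *)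

(* Defs.v *)
(* Finite dimensional Hopf algebras over a field, their Drinfeld doubles, and
   lazy 2-cocycles, in the Mathematical Components library. *)
From HB Require Import structures.
From mathcomp Require Import all_boot all_algebra all_field.

Set Implicit Arguments.
Unset Strict Implicit.
Unset Printing Implicit Defensive.

Import GRing.Theory.
Local Open Scope ring_scope.

(** * Tensor products of finite dimensional vector spaces *)

(* [tensor V W] is realized by the coefficient matrices with respect to the
   chosen bases of V and W; [tens] is the universal bilinear map, and
   [tlift f] the map that it induces when f is bilinear (see [tlift_tens] and
   [tensor_ext] for the universal property). *)
Definition tensor (k : fieldType) (V W : vectType k) : Type :=
  'M[k]_(\dim {:V}, \dim {:W}).

HB.instance Definition _ (k : fieldType) (V W : vectType k) :=
  Vector.copy (tensor V W) 'M[k]_(\dim {:V}, \dim {:W}).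

Definition tens (k : fieldType) (V W : vectType k) (v : V) (w : W) :
    tensor V W :=
  \matrix_(i, j) (coord (vbasis {:V}) i v * coord (vbasis {:W}) j w).

Definition tlift (k : fieldType) (V W : vectType k) (U : lmodType k)
    (f : V -> W -> U) (t : tensor V W) : U :=
  \sum_i \sum_j
    (t : 'M[k]_(_, _)) i j *: f (vbasis {:V})`_i (vbasis {:W})`_j.

Notation "V ⊗ W" := (tensor V W)
  (at level 40, left associativity) : type_scope.
Notation "v ⊗ w" := (tens v w)
  (at level 40, left associativity) : ring_scope.

(* \ten_(a, b <- t) F  is the value at t of the linear map a ⊗ b |-> F. *)
Notation "\ten_ ( a , b <- t ) F" := (tlift (fun a b => F) t)
  (at level 41, F at level 41, t at level 100, a name, b name,
   format "'[' \ten_ ( a ,  b  <-  t ) '/  '  F ']'") : ring_scope.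

(* Iterated Sweedler notation:  \ten3_(a, b, c <- x | D) F  is F(x_1, x_2, x_3)
   for the comultiplication D, with x_1 ⊗ x_2 ⊗ x_3 = x_1 ⊗ D(x_2). *)
Definition tlift3 (k : fieldType) (V : vectType k) (U : lmodType k)
    (D : V -> (V ⊗ V)%type) (f : V -> V -> V -> U) (x : V) : U :=
  \ten_(a, y <- D x) \ten_(b, c <- D y) f a b c.

Notation "\ten3_ ( a , b , c <- x | D ) F" :=
  (tlift3 D (fun a b c => F) x)
  (at level 41, F at level 41, x at level 100, D at level 100,
   a name, b name, c name,
   format "'[' \ten3_ ( a ,  b ,  c  <-  x  |  D ) '/  '  F ']'") : ring_scope.

Lemma tlift_is_linear (k : fieldType) (V W : vectType k) (U : lmodType k)
  (f : V -> W -> U) : linear (tlift f).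
Proof.
move=> a s t; rewrite /tlift scaler_sumr -big_split; apply: eq_bigr => i _ /=.
rewrite scaler_sumr -big_split; apply: eq_bigr => j _ /=.
by rewrite !mxE scalerDl scalerA.
Qed.

HB.instance Definition _ (k : fieldType) (V W : vectType k) (U : lmodType k)
    (f : V -> W -> U) :=
  GRing.isLinear.Build k (V ⊗ W)%type U _ (tlift f) (tlift_is_linear f).

Lemma tlift_tens (k : fieldType) (V W : vectType k) (U : lmodType k)
    (f : V -> W -> U) (v : V) (w : W) :
    (forall w', linear (f^~ w')) -> (forall v', linear (f v')) ->
  tlift f (v ⊗ w) = f v w.
Proof.
move=> fl fr.
pose fL w' : {linear V -> U} := HB.pack (f^~ w')
  (GRing.isLinear.Build _ _ _ _ _ (fl w')).
pose fR v' : {linear W -> U} := HB.pack (f v')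
  (GRing.isLinear.Build _ _ _ _ _ (fr v')).
rewrite [in RHS](coord_vbasis (memvf v)) -[RHS]/(fL w _) linear_sum.
apply: eq_bigr => i _; rewrite linearZ /= -[f _ w]/(fR _ w).
rewrite [in RHS](coord_vbasis (memvf w)) linear_sum scaler_sumr.
by apply: eq_bigr => j _; rewrite linearZ /= scalerA mxE.
Qed.

Lemma tensor_ext (k : fieldType) (V W : vectType k) (U : lmodType k)
    (f g : {linear (V ⊗ W)%type -> U}) :
  (forall v w, f (v ⊗ w) = g (v ⊗ w)) -> f =1 g.
Proof.
move=> fg t.
have -> : t = \ten_(v, w <- t) (v ⊗ w).
  apply/matrixP => i j; rewrite /tlift summxE (bigD1 i) //= summxE (bigD1 j) //=.
  have freeV := basis_free (vbasisP {:V}).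
  have freeW := basis_free (vbasisP {:W}).
  rewrite !mxE !coord_free // !eqxx !mulr1.
  have ne n (a b : 'I_n) : a != b -> (a == b) = false /\ (b == a) = false.
    by move=> ab; split; apply: negbTE; rewrite // eq_sym.
  rewrite !big1 ?addr0 // => [i' /ne[ii' i'i]|j' /ne[jj' j'j]].
    rewrite summxE big1 // => j' _.
    by rewrite !mxE !coord_free // ?ii' ?i'i mul0r mulr0.
  by rewrite !mxE !coord_free // ?jj' ?j'j !mulr0.
rewrite /tlift !linear_sum; apply: eq_bigr => i _.
rewrite !linear_sum; apply: eq_bigr => j _.
by rewrite !linearZ /= fg.
Qed.

(** * Finite dimensional Hopf algebras *)

HB.mixin Record Falgebra_isHopf (k : fieldType) H of Falgebra k H := {
  comul : 'Hom(H, (H ⊗ H)%type);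
  counit : 'Hom(H, k^o);
  antipode : 'End(H);
  comulA : forall h : H,
    \ten_(h1, y <- comul h) \ten_(h2, h3 <- comul y) (h1 ⊗ h2 ⊗ h3)
    = \ten_(y, h3 <- comul h) \ten_(h1, h2 <- comul y) (h1 ⊗ h2 ⊗ h3);
  counitl : forall h : H, \ten_(h1, h2 <- comul h) (counit h1 *: h2) = h;
  counitr : forall h : H, \ten_(h1, h2 <- comul h) (counit h2 *: h1) = h;
  comulM : forall g h : H,
    comul (g * h) = \ten_(g1, g2 <- comul g) \ten_(h1, h2 <- comul h)
                      ((g1 * h1) ⊗ (g2 * h2));
  comul1 : comul 1 = 1 ⊗ 1;
  counitM : forall g h : H, counit (g * h) = counit g * counit h;
  counit1 : counit 1 = 1;
  antipodel : forall h : H,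
    \ten_(h1, h2 <- comul h) (antipode h1 * h2) = (counit h : k)%:A;
  antipoder : forall h : H,
    \ten_(h1, h2 <- comul h) (h1 * antipode h2) = (counit h : k)%:A
}.

#[short(type="hopfAlgType")]
HB.structure Definition HopfAlg (k : fieldType) :=
  { H of Falgebra_isHopf k H & Falgebra k H }.

Arguments comul {k H} : rename.
Arguments counit {k H} : rename.
Arguments antipode {k H} : rename.

(* The antipode of a finite dimensional Hopf algebra is bijective (Larson and
   Sweedler), so that the generalized inverse of [vector] is its inverse. *)
Definition antipodeV (k : fieldType) (H : hopfAlgType k) : 'End(H) :=
  (@antipode k H)^-1%VF.

(** * Cocycles *)

(* The operations of a bialgebra, without the axioms: the notions below only
   involve these operations. *)
Record bialgOps (k : fieldType) := BialgOps {
  bcarrier :> vectType k;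
  bmul : bcarrier -> bcarrier -> bcarrier;
  bone : bcarrier;
  bcomul : bcarrier -> (bcarrier ⊗ bcarrier)%type;
  bcounit : bcarrier -> k^o
}.

Definition hopf_ops (k : fieldType) (H : hopfAlgType k) : bialgOps k :=
  @BialgOps k H *%R 1 comul counit.

Section Cocycles.
Variables (k : fieldType) (K : bialgOps k).
Implicit Types (sigma tau : 'Hom((K ⊗ K)%type, k^o)).

Local Notation Delta := (@bcomul k K).
Local Notation eps := (@bcounit k K).
Local Notation "x ** y" := (@bmul k K x y) (at level 40, left associativity).

Definition conv_inverse sigma tau : Prop :=
  forall x y : K,
    \ten_(x1, x2 <- Delta x) \ten_(y1, y2 <- Delta y)
      (sigma (x1 ⊗ y1) * tau (x2 ⊗ y2)) = eps x * eps y
 /\ \ten_(x1, x2 <- Delta x) \ten_(y1, y2 <- Delta y)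
      (tau (x1 ⊗ y1) * sigma (x2 ⊗ y2)) = eps x * eps y.

Definition normalized sigma : Prop :=
  forall x : K, sigma (@bone k K ⊗ x) = eps x
             /\ sigma (x ⊗ @bone k K) = eps x.

Definition Reg2 sigma : Prop :=
  (exists tau, conv_inverse sigma tau) /\ normalized sigma.

Definition lazy_cochain sigma : Prop :=
  forall x y : K,
    \ten_(x1, x2 <- Delta x) \ten_(y1, y2 <- Delta y)
      ((sigma (x1 ⊗ y1) : k) *: (x2 ** y2))
  = \ten_(x1, x2 <- Delta x) \ten_(y1, y2 <- Delta y)
      ((sigma (x2 ⊗ y2) : k) *: (x1 ** y1)).

Definition left_cocycle sigma : Prop :=
  forall a b c : K,
    \ten_(a1, a2 <- Delta a) \ten_(b1, b2 <- Delta b)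
      (sigma (a1 ⊗ b1) * sigma ((a2 ** b2) ⊗ c))
  = \ten_(b1, b2 <- Delta b) \ten_(c1, c2 <- Delta c)
      (sigma (b1 ⊗ c1) * sigma (a ⊗ (b2 ** c2))).

Definition pure sigma : Prop :=
  exists2 tau, conv_inverse sigma tau &
  forall a b c d : K,
    \ten3_(b1, b2, b3 <- b | Delta) \ten3_(c1, c2, c3 <- c | Delta)
      (sigma ((a ** b1) ⊗ c1) * tau (b2 ⊗ c2) * sigma (b3 ⊗ (c3 ** d)))
  = \ten3_(b1, b2, b3 <- b | Delta) \ten3_(c1, c2, c3 <- c | Delta)
      (sigma (b1 ⊗ (c1 ** d)) * tau (b2 ⊗ c2) * sigma ((a ** b3) ⊗ c3)).

Definition neat sigma : Prop :=
  forall a b c : K,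
    \ten_(b1, b2 <- Delta b) (sigma (a ⊗ b1) * sigma (b2 ⊗ c))
  = \ten_(b1, b2 <- Delta b) (sigma (b1 ⊗ c) * sigma (a ⊗ b2)).

Definition Z2L sigma : Prop :=
  [/\ Reg2 sigma, lazy_cochain sigma & left_cocycle sigma].

Definition Z2PL sigma : Prop := Z2L sigma /\ pure sigma.

Definition Z2NL sigma : Prop := Z2L sigma /\ neat sigma.

End Cocycles.

(** * The Drinfeld double *)

Section DrinfeldDouble.
Variables (k : fieldType) (H : hopfAlgType k).

Definition dual : vectType k := 'Hom(H, k^o).

Definition dual_mul (p q : dual) : dual :=
  linfun (fun x : H => \ten_(x1, x2 <- comul x) (p x1 * q x2)).

Definition dual_coord (i : 'I_(\dim {:H})) : dual :=
  linfun (coord (vbasis {:H}) i : H -> k^o).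

(* The comultiplication of H^* is the transpose of the multiplication of H,
   written here on the dual basis; see [dual_comulE]. *)
Definition dual_comul (p : dual) : (dual ⊗ dual)%type :=
  \sum_(i < \dim {:H}) \sum_(j < \dim {:H})
    (p ((vbasis {:H})`_i * (vbasis {:H})`_j) : k) *: (dual_coord i ⊗ dual_coord j).

Definition lact (h : H) (p : dual) : dual := linfun (fun l : H => p (l * h)).
Definition ract (p : dual) (h : H) : dual := linfun (fun l : H => p (h * l)).

Local Notation "h ⇀ p" := (lact h p) (at level 41, right associativity).
Local Notation "p ↼ h" := (ract p h) (at level 40, left associativity).

Definition drinfeld : vectType k := (dual ⊗ H)%type.

Definition double_mul (x y : drinfeld) : drinfeld :=
  \ten_(p, h <- x) \ten_(q, l <- y) \ten3_(h1, h2, h3 <- h | comul)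
    (dual_mul p (h1 ⇀ (q ↼ antipodeV H h3)) ⊗ (h2 * l)).

(* The coalgebra H^{*cop} ⊗ H. *)
Definition double_comul (x : drinfeld) : (drinfeld ⊗ drinfeld)%type :=
  \ten_(p, h <- x) \ten_(p1, p2 <- dual_comul p) \ten_(h1, h2 <- comul h)
    ((p2 ⊗ h1) ⊗ (p1 ⊗ h2)).

Definition double_counit (x : drinfeld) : k^o :=
  \ten_(p, h <- x) ((p : dual) 1 * counit h).

Definition double_ops : bialgOps k :=
  @BialgOps k drinfeld double_mul ((counit : dual) ⊗ (1 : H))
    double_comul double_counit.

Definition sigma_bar (sigma : 'Hom((H ⊗ H)%type, k^o)) :
    'Hom((drinfeld ⊗ drinfeld)%type, k^o) :=
  linfun (fun t : (drinfeld ⊗ drinfeld)%type =>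
    \ten_(x, y <- t) \ten_(p, h <- x) \ten_(q, l <- y)
      \ten3_(h1, h2, h3 <- h | comul)
        ((p : dual) 1 * (q : dual) (antipodeV H h3 * h1) * sigma (h2 ⊗ l))).

Lemma linfunE (V W : vectType k) (f : V -> W) :
  linear f -> linfun f =1 f.
Proof.
move=> lf; pose g : {linear V -> W} := HB.pack f
  (GRing.isLinear.Build _ _ _ _ _ lf).
exact: (lfunE g).
Qed.

Lemma lactE h (p : dual) (l : H) : (h ⇀ p) l = p (l * h).
Proof. by rewrite linfunE // => a u v; rewrite mulrDl -scalerAl linearP. Qed.

Lemma ractE h (p : dual) (l : H) : (p ↼ h) l = p (h * l).
Proof. by rewrite linfunE // => a u v; rewrite mulrDr -scalerAr linearP. Qed.

Lemma dual_mulE (p q : dual) (x : H) :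
  dual_mul p q x = \ten_(x1, x2 <- comul x) (p x1 * q x2).
Proof. by rewrite linfunE // => a u v; rewrite !linearP. Qed.

Lemma dual_comulE (p : dual) (x y : H) :
  \ten_(p1, p2 <- dual_comul p) ((p1 : dual) x * (p2 : dual) y) = p (x * y).
Proof.
have dcE i (z : H) : dual_coord i z = coord (vbasis {:H}) i z.
  by rewrite linfunE // => a u v; rewrite linearP.
rewrite [x in RHS](coord_vbasis (memvf x)) [y in RHS](coord_vbasis (memvf y)).
rewrite mulr_suml !linear_sum; apply: eq_bigr => i _.
rewrite mulr_sumr !linear_sum; apply: eq_bigr => j _ /=.
rewrite [LHS]linearZ /= tlift_tens.
- rewrite !dcE -scalerAl -scalerAr !linearZ /= /GRing.scale /=.
  by congr (_ * _); apply: mulrC.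
- by move=> w c u v; rewrite add_lfunE scale_lfunE mulrDl -scalerAl.
- by move=> w c u v; rewrite add_lfunE scale_lfunE mulrDr -scalerAr.
Qed.

Lemma tlift_linear (T V W : vectType k) (U : lmodType k)
    (f : T -> V -> W -> U) (t : (V ⊗ W)%type) :
    (forall v w, linear (fun u => f u v w)) ->
  linear (fun u => tlift (f u) t).
Proof.
move=> lf a u v; rewrite /tlift scaler_sumr -big_split; apply: eq_bigr => i _ /=.
rewrite scaler_sumr -big_split; apply: eq_bigr => j _ /=.
by rewrite lf scalerDr !scalerA mulrC.
Qed.

Lemma tensDl (V W : vectType k) (w : W) : linear (fun v : V => v ⊗ w).
Proof.
by move=> a u v; apply/matrixP => i j; rewrite !mxE linearP mulrDl mulrA.
Qed.

Lemma tensDr (V W : vectType k) (v : V) : linear (fun w : W => v ⊗ w).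
Proof.
move=> a u w; apply/matrixP => i j.
by rewrite !mxE linearP mulrDr mulrCA.
Qed.

Lemma sigma_barE (sigma : 'Hom((H ⊗ H)%type, k^o)) (p q : dual) (h l : H) :
  sigma_bar sigma ((p ⊗ h : drinfeld) ⊗ (q ⊗ l : drinfeld))
  = \ten3_(h1, h2, h3 <- h | comul)
      (p 1 * q (antipodeV H h3 * h1) * sigma (h2 ⊗ l)).
Proof.
rewrite linfunE => [|a u v]; last by rewrite linearP.
rewrite tlift_tens.
- rewrite tlift_tens.
  + rewrite tlift_tens //.
    * move=> l'; apply: tlift_linear => h1 y; apply: tlift_linear => h2 h3 a u v.
      by rewrite add_lfunE scale_lfunE mulrDr mulrDl -scalerAr -scalerAl.
    * move=> q'; apply: tlift_linear => h1 y; apply: tlift_linear => h2 h3 a u v.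
      by rewrite tensDr linearP mulrDr -scalerAr.
  + move=> h'; apply: tlift_linear => q' l'; apply: tlift_linear => h1 y.
    apply: tlift_linear => h2 h3 a u v.
    rewrite add_lfunE scale_lfunE !mulrDl; congr (_ + _).
    by rewrite /GRing.scale /= -!mulrA.
  + move=> p'; apply: tlift_linear => q' l' a u v.
    by rewrite /tlift3 !linearP.
- move=> y a u v; by rewrite linearP.
- move=> x; apply: tlift_linear => p' h' a u v; by rewrite linearP.
Qed.

End DrinfeldDouble.

(* Main.v *)
(* For a coalgebra C and an algebra R, Hom(C, R) is an algebra under
   convolution, so cochains on several copies of D = D(H) live in the iterated
   algebras Hom(D, Hom(D, ... R)).  There, the product of D is the product of
   the tensor product bialgebra H^*cop ⊗ H deformed by the cochain
     W (p ⊗ h, q ⊗ l) = p(1) q(h) ε(l),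
   and sigma_bar = W F W^-1, where F (p ⊗ h, q ⊗ l) = p(1) q(1) σ(h, l).
   With subscripts for the arguments on which a cochain depends, put
     G = W12 W23 W13 = W23 W12 W13.
   Laziness says that F12 commutes with W23 W13 = W ∘ (mul ⊗ id), and W12 W13
   commutes with F23; hence sigma_bar_12, sigma_bar_23,
   sigma_bar ∘ (mul ⊗ id) and sigma_bar ∘ (id ⊗ mul) are the conjugates by G
   of the corresponding cochains of H, and the cocycle and neatness identities
   transfer.  For purity, which has four arguments, the same holds with
   G W34 W24 W14 in place of G.  W is invertible because
   u |-> (q ⊗ l |-> q(u) ε(l)) is antimultiplicative and S is bijective. *)

(* The convolution algebras are iterated, rather than formed over tensor product coalgebras, because
   [conv C R] is again a finite dimensional algebra: a cochain keeps its formula while further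
   arguments hide in [R], and inserting an argument, changing values or composing with a coalgebra
   map is always an algebra morphism. The projection of D onto H is a coalgebra map but not
   multiplicative, so identities of H cannot simply be pulled back to D; conjugation measures the
   defect. Each cochain comes naturally as a conjugate by only some factors of G, whereas a transfer
   needs one conjugating element for all of them: the missing factors are inserted because they
   commute with what they conjugate. These commutations have few sources: factors on disjoint
   arguments, the separation of the H^* and H factors of D, and laziness, by which F commutes with
   every cochain that factors through the product of H. Bijectivity of S is not among the axioms,
   and [antipodeV] is only a generalized inverse. It is proved here from a Fitting decomposition of
   an even power of S, without integrals. *)
From HB Require Import structures.
Require Import Defs.
From mathcomp Require Import all_boot all_algebra all_field.

Set Implicit Arguments.
Unset Strict Implicit.
Unset Printing Implicit Defensive.

Import GRing.Theory.
Local Open Scope ring_scope.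

(** * Linearity and sums over tensors *)

Section Linearity.
Variables (k : fieldType) (U V W : lmodType k).

Lemma linear_id : linear (fun x : U => x).
Proof. by []. Qed.

Lemma linear_comp (g : V -> W) (f : U -> V) :
  linear g -> linear f -> linear (fun x => g (f x)).
Proof. by move=> lg lf a u v; rewrite lf lg. Qed.

Lemma linear_fun (g : {linear V -> W}) (f : U -> V) :
  linear f -> linear (fun x => g (f x)).
Proof. by move=> lf a u v; rewrite lf linearP. Qed.

Lemma linear_scaleE (g : U -> V) (a : k) (u : U) :
  linear g -> g (a *: u) = a *: g u.
Proof.
move=> lg; have g0 : g 0 = 0.
  by have := lg (-1) 0 0; rewrite scaler0 addr0 scaleN1r addNr.
by have := lg a u 0; rewrite !addr0 g0 addr0.
Qed.

Lemma linear_scale_r (a : k) (f : U -> V) :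
  linear f -> linear (fun x => a *: f x).
Proof. by move=> lf b u v; rewrite lf scalerDr !scalerA mulrC. Qed.

Lemma linear_scale_l (f : U -> k^o) (v : V) :
  linear f -> linear (fun x => (f x : k) *: v).
Proof. by move=> lf a u w; rewrite lf scalerDl scalerA. Qed.

Lemma linear_mul_r (R : algType k) (a : R) (f : U -> R) :
  linear f -> linear (fun x => a * f x).
Proof. by move=> lf b u v; rewrite lf mulrDr scalerAr. Qed.

Lemma linear_mul_l (R : algType k) (a : R) (f : U -> R) :
  linear f -> linear (fun x => f x * a).
Proof. by move=> lf b u v; rewrite lf mulrDl scalerAl. Qed.

End Linearity.

Section LinearityTensor.
Variables (k : fieldType) (U : lmodType k) (V W : vectType k).

Lemma linear_lfun_app (f : U -> 'Hom(V, W)) (v : V) :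
  linear f -> linear (fun x => f x v).
Proof. by move=> lf a u w; rewrite lf add_lfunE scale_lfunE. Qed.

Lemma linear_tens_r (a : V) (f : U -> W) :
  linear f -> linear (fun x => a ⊗ f x).
Proof. by move=> lf b u v; rewrite lf tensDr. Qed.

Lemma linear_tens_l (a : W) (f : U -> V) :
  linear f -> linear (fun x => f x ⊗ a).
Proof. by move=> lf b u v; rewrite lf tensDl. Qed.

Lemma linear_tlift_arg (T : lmodType k) (g : V -> W -> T)
    (f : U -> (V ⊗ W)%type) :
  linear f -> linear (fun x => tlift g (f x)).
Proof. by move=> lf a u v; rewrite lf linearP. Qed.

Lemma linear_tlift_fun (T : lmodType k) (g : U -> V -> W -> T)
    (t : (V ⊗ W)%type) :
  (forall v w, linear (fun x => g x v w)) -> linear (fun x => tlift (g x) t).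
Proof.
move=> lg a u v; rewrite /tlift scaler_sumr -big_split; apply: eq_bigr => i _ /=.
rewrite scaler_sumr -big_split; apply: eq_bigr => j _ /=.
by rewrite lg scalerDr !scalerA mulrC.
Qed.

Lemma linear_linfun (f : U -> V -> W) :
  (forall y, linear (fun x => f x y)) -> (forall x, linear (f x)) ->
  linear (fun x => linfun (f x)).
Proof.
move=> f1 f2 a u v; apply/lfunP => y.
by rewrite add_lfunE scale_lfunE !linfunE // f1.
Qed.

End LinearityTensor.

(* Dispatching on the syntactic form keeps unification from unfolding the
   nested algebra structures. *)
Ltac lin_arg f g lemr leml :=
  lazymatch f with
  | (fun _ => ?a) => lemr a
  | _ => lazymatch g with (fun _ => ?a) => leml a end
  end.

Ltac lin_step :=
  lazymatch goal with
  | |- _ (fun x => x) => apply: linear_id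
  | |- _ (fun x => GRing.mul (@?f x) (@?g x)) =>
      lin_arg f g ltac:(fun a => apply: (linear_mul_r a))
                  ltac:(fun a => apply: (linear_mul_l a))
  | |- _ (fun x => GRing.scale (@?f x) (@?g x)) =>
      lin_arg f g ltac:(fun a => apply: (linear_scale_r a))
                  ltac:(fun a => apply: (linear_scale_l a))
  | |- _ (fun x => tens (@?f x) (@?g x)) =>
      lin_arg f g ltac:(fun a => apply: (linear_tens_r a))
                  ltac:(fun a => apply: (linear_tens_l a))
  | |- _ (fun x => tlift (@?f x) (@?g x)) =>
      lin_arg f g ltac:(fun a => apply: (linear_tlift_arg a))
                  ltac:(fun a => apply: linear_tlift_fun)
  | |- _ (fun x => fun_of_lfun (@?f x) (@?g x)) =>
      lin_arg f g ltac:(fun a => first [solve [auto] | apply: linear_fun])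
                  ltac:(fun a => apply: (linear_lfun_app a))
  | |- _ (GRing.mul ?a) => exact: (linear_mul_r a (@linear_id _ _))
  | |- _ (fun x => linfun (@?f x)) => apply: linear_linfun
  | |- _ => first [solve [auto] | apply: linear_id | exact: tensDr
     | apply: linear_fun
     | apply: linear_tlift_arg | apply: linear_tlift_fun]
  end.

Ltac lin := rewrite /tlift3; repeat (intros; cbv beta; lin_step).

Lemma lfunZ (k : fieldType) (V W : vectType k) (f : 'Hom(V, W)) (a : k) (v : V) :
  f (a *: v) = a *: f v.
Proof. exact: linearZ. Qed.

Section TensorSums.
Variables (k : fieldType).
Implicit Types (U T : lmodType k) (V W : vectType k).

Lemma eq_tlift U V W (f g : V -> W -> U) (t : (V ⊗ W)%type) :
  (forall v w, f v w = g v w) -> tlift f t = tlift g t.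
Proof. by move=> fg; apply: eq_bigr => i _; apply: eq_bigr => j _; rewrite fg. Qed.

Lemma linear_tlift U T V W (g : {linear U -> T}) (f : V -> W -> U)
    (t : (V ⊗ W)%type) :
  g (tlift f t) = \ten_(v, w <- t) g (f v w).
Proof.
rewrite /tlift linear_sum; apply: eq_bigr => i _.
by rewrite linear_sum; apply: eq_bigr => j _; rewrite linearZ.
Qed.

Lemma linear_tlift_of U T V W (g : U -> T) (f : V -> W -> U) (t : (V ⊗ W)%type) :
  linear g -> g (tlift f t) = \ten_(v, w <- t) g (f v w).
Proof.
move=> lg; pose g' : {linear U -> T} := HB.pack g
  (GRing.isLinear.Build _ _ _ _ _ lg).
exact: (linear_tlift g').
Qed.

Lemma tlift_app V W V' W' (f : V -> W -> 'Hom(V', W')) (t : (V ⊗ W)%type) v :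
  tlift f t v = \ten_(a, b <- t) f a b v.
Proof. apply: (linear_tlift_of (g := fun h : 'Hom(V', W') => h v)); lin. Qed.

Lemma mulr_tliftl (R : algType k) V W (f : V -> W -> R) (t : (V ⊗ W)%type) r :
  tlift f t * r = \ten_(a, b <- t) (f a b * r).
Proof. by apply: (linear_tlift_of (g := fun x => x * r)); lin. Qed.

Lemma mulr_tliftr (R : algType k) V W (f : V -> W -> R) (t : (V ⊗ W)%type) r :
  r * tlift f t = \ten_(a, b <- t) (r * f a b).
Proof. by apply: (linear_tlift_of (g := fun x => r * x)); lin. Qed.

Lemma scaler_tlift U V W (f : V -> W -> U) (t : (V ⊗ W)%type) (c : k) :
  c *: tlift f t = \ten_(a, b <- t) (c *: f a b).
Proof. by apply: (linear_tlift_of (g := fun x => c *: x)); lin. Qed.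

Lemma scaler_tliftl U V W (f : V -> W -> k^o) (t : (V ⊗ W)%type) (u : U) :
  (tlift f t : k) *: u = \ten_(a, b <- t) ((f a b : k) *: u).
Proof. by apply: (linear_tlift_of (g := fun x : k^o => (x : k) *: u)); lin. Qed.

Lemma exchange_tlift U V W V' W' (f : V -> W -> V' -> W' -> U)
    (t : (V ⊗ W)%type) (t' : (V' ⊗ W')%type) :
  \ten_(a, b <- t) \ten_(c, d <- t') f a b c d =
  \ten_(c, d <- t') \ten_(a, b <- t) f a b c d.
Proof.
rewrite /tlift; under eq_bigr => i _ do under eq_bigr => j _ do
  [rewrite scaler_sumr; under eq_bigr => i' _ do rewrite scaler_sumr].
under [RHS]eq_bigr => i _ do under eq_bigr => j _ do
  [rewrite scaler_sumr; under eq_bigr => i' _ do rewrite scaler_sumr].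
rewrite pair_big [RHS]pair_big /=.
under eq_bigr => p _ do rewrite pair_big /=.
under [RHS]eq_bigr => p _ do rewrite pair_big /=.
rewrite exchange_big; apply: eq_bigr => p _; apply: eq_bigr => q _ /=.
by rewrite !scalerA mulrC.
Qed.

End TensorSums.

(** * Convolution algebras *)

(** The field [ceps_neq0] excludes the zero coalgebra, over which convolution algebras would vanish;
    rings here satisfy 1 != 0. *)
Record coalg (k : fieldType) := Coalg {
  ccarrier :> vectType k;
  cdelta : ccarrier -> (ccarrier ⊗ ccarrier)%type;
  ceps : ccarrier -> k^o;
  cdelta_linear : linear cdelta;
  ceps_linear : linear ceps;
  cdeltaA : forall x,
    \ten_(a, y <- cdelta x) \ten_(b, c <- cdelta y) (a ⊗ b ⊗ c)
    = \ten_(y, c <- cdelta x) \ten_(a, b <- cdelta y) (a ⊗ b ⊗ c);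
  cepsl : forall x, \ten_(a, b <- cdelta x) (ceps a *: b) = x;
  cepsr : forall x, \ten_(a, b <- cdelta x) (ceps b *: a) = x;
  ceps_neq0 : exists x, ceps x != 0
}.

HB.instance Definition _ (k : fieldType) (C : coalg k) :=
  GRing.isLinear.Build k C (C ⊗ C)%type _ (@cdelta k C) (@cdelta_linear k C).
HB.instance Definition _ (k : fieldType) (C : coalg k) :=
  GRing.isLinear.Build k C k^o _ (@ceps k C) (@ceps_linear k C).

(** Applying the linear map [L] that [F] induces on C ⊗ C ⊗ C to the coassociativity axiom turns it
    into the rule for regrouping iterated Sweedler sums. *)
Lemma coassoc_tlift (k : fieldType) (C : vectType k) (x : C)
    (Delta : {linear C -> (C ⊗ C)%type})
    (U : lmodType k) (F : C -> C -> C -> U) :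
  \ten_(a, y <- Delta x) \ten_(b, c <- Delta y) (a ⊗ b ⊗ c)
    = \ten_(y, c <- Delta x) \ten_(a, b <- Delta y) (a ⊗ b ⊗ c) ->
  (forall b c, linear (fun a => F a b c)) ->
  (forall a c, linear (fun b => F a b c)) ->
  (forall a b, linear (fun c => F a b c)) ->
  \ten_(a, y <- Delta x) \ten_(b, c <- Delta y) F a b c
    = \ten_(y, c <- Delta x) \ten_(a, b <- Delta y) F a b c.
Proof.
move=> DA F1 F2 F3.
pose L (t : (C ⊗ C ⊗ C)%type) := \ten_(y, c <- t) \ten_(a, b <- y) F a b c.
have lL : linear L by lin.
have LE a b c : L (a ⊗ b ⊗ c) = F a b c.
  by rewrite /L !tlift_tens //; lin.
have /(congr1 L) := DA.
rewrite !(linear_tlift_of _ _ lL) => E; transitivity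
  (\ten_(a, y <- Delta x) L (\ten_(b, c <- Delta y) (a ⊗ b ⊗ c))).
  by apply: eq_tlift => a y; rewrite (linear_tlift_of _ _ lL); apply: eq_tlift
    => b c.
rewrite E; apply: eq_tlift => y c; rewrite (linear_tlift_of _ _ lL).
exact: eq_tlift.
Qed.

(** A separate name carries the convolution product. Finite dimension supplies the unit ring
    structure, hence conjugation, and lets [conv C R] serve as [R] in turn. *)
Definition conv (k : fieldType) (C : coalg k) (R : falgType k) : Type := 'Hom(C, R).

HB.instance Definition _ (k : fieldType) (C : coalg k) (R : falgType k) :=
  Vector.copy (conv C R) 'Hom(C, R).

Section Convolution.
Variables (k : fieldType) (C : coalg k) (R : falgType k).
Implicit Types f g h : conv C R.

Local Notation app f := (fun_of_lfun (f : 'Hom(C, R))).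

Definition conv_one : conv C R := linfun (fun x => (ceps x : k)%:A : R).
Definition conv_mul f g : conv C R :=
  linfun (fun x => \ten_(a, b <- cdelta x) (app f a * app g b) : R).

Lemma conv_oneE x : app conv_one x = (ceps x : k)%:A.
Proof. by rewrite linfunE //; lin. Qed.

Lemma conv_mulE f g x :
  app (conv_mul f g) x = \ten_(a, b <- cdelta x) (app f a * app g b).
Proof. by rewrite linfunE //; lin. Qed.

Lemma conv_mulA : associative conv_mul.
Proof.
move=> f g h; apply/lfunP => x; rewrite !conv_mulE.
transitivity (\ten_(a, y <- cdelta x) \ten_(b, c <- cdelta y)
    (app f a * (app g b * app h c))).
  by apply: eq_tlift => a y; rewrite conv_mulE mulr_tliftr.
rewrite (coassoc_tlift (cdeltaA x)); [|lin..].
apply: eq_tlift => y c; rewrite conv_mulE mulr_tliftl.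
by apply: eq_tlift => a b; rewrite mulrA.
Qed.

Lemma conv_mul1l : left_id conv_one conv_mul.
Proof.
move=> f; apply/lfunP => x; rewrite !conv_mulE -[in RHS](cepsl x).
rewrite [RHS]linear_tlift; apply: eq_tlift => a b.
by rewrite conv_oneE mulr_algl linearZ.
Qed.

Lemma conv_mul1r : right_id conv_one conv_mul.
Proof.
move=> f; apply/lfunP => x; rewrite !conv_mulE -[in RHS](cepsr x).
rewrite [RHS]linear_tlift; apply: eq_tlift => a b.
by rewrite conv_oneE mulr_algr linearZ.
Qed.

Lemma conv_mulDl : left_distributive conv_mul +%R.
Proof.
move=> f g h; apply/lfunP => x; rewrite !conv_mulE add_lfunE !conv_mulE.
by rewrite /tlift -big_split; apply: eq_bigr => i _; rewrite -big_split;
  apply: eq_bigr => j _; rewrite add_lfunE mulrDl scalerDr.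
Qed.

Lemma conv_mulDr : right_distributive conv_mul +%R.
Proof.
move=> f g h; apply/lfunP => x; rewrite !conv_mulE add_lfunE !conv_mulE.
by rewrite /tlift -big_split; apply: eq_bigr => i _; rewrite -big_split;
  apply: eq_bigr => j _; rewrite add_lfunE mulrDr scalerDr.
Qed.

Lemma conv_one_neq0 : conv_one != 0.
Proof.
have [x ex] := ceps_neq0 C; apply/eqP => /lfunP/(_ x).
rewrite conv_oneE zero_lfunE => /eqP.
by rewrite scaler_eq0 oner_eq0 orbF (negbTE ex).
Qed.

HB.instance Definition _ := GRing.Zmodule_isNzRing.Build (conv C R)
  conv_mulA conv_mul1l conv_mul1r conv_mulDl conv_mulDr conv_one_neq0.

Lemma conv_scaleAl (a : k) f g : a *: (f * g) = a *: f * g.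
Proof.
apply/lfunP => x; rewrite scale_lfunE !conv_mulE linear_tlift.
by apply: eq_tlift => b c /=; rewrite scale_lfunE scalerAl.
Qed.

HB.instance Definition _ := GRing.Lmodule_isLalgebra.Build k (conv C R)
  conv_scaleAl.

Lemma conv_scaleAr (a : k) f g : a *: (f * g) = f * (a *: g).
Proof.
apply/lfunP => x; rewrite scale_lfunE !conv_mulE linear_tlift.
by apply: eq_tlift => b c /=; rewrite scale_lfunE scalerAr.
Qed.

HB.instance Definition _ := GRing.Lalgebra_isAlgebra.Build k (conv C R)
  conv_scaleAr.
HB.instance Definition _ := Algebra_isFalgebra.Build k (conv C R).

End Convolution.

Section ConvolutionTheory.
Variables (k : fieldType) (C : coalg k) (R : falgType k).
Implicit Types f g : conv C R.

Lemma convE f g x : (f * g) x = \ten_(a, b <- cdelta x) (f a * g b).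
Proof. exact: conv_mulE. Qed.

Lemma conv1E (x : C) : (1 : conv C R) x = (ceps x : k)%:A.
Proof. exact: conv_oneE. Qed.

Lemma convD f g x : (f + g) x = f x + g x.
Proof. exact: add_lfunE. Qed.

Lemma convZ a f x : (a *: f) x = a *: f x.
Proof. exact: scale_lfunE. Qed.

End ConvolutionTheory.

(** * The coalgebra of the Drinfeld double *)

(** Transparent, so that [cdelta] and [ceps] reduce to [comul] and [counit]. *)
Definition hopf_coalg (k : fieldType) (H : hopfAlgType k) : coalg k.
Proof.
apply: (@Coalg k H comul counit (@linearP _ _ _ _ _) (@linearP _ _ _ _ _)
  comulA counitl counitr).
by exists 1; rewrite counit1 oner_neq0.
Defined.

Section DoubleCoalgebra.
Variables (k : fieldType) (H : hopfAlgType k).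
Local Notation e_ i := ((vbasis {:H})`_i).

Lemma dual_comul_linear : linear (@dual_comul k H).
Proof.
move=> a p q; rewrite /dual_comul scaler_sumr -big_split; apply: eq_bigr => i _ /=.
rewrite scaler_sumr -big_split; apply: eq_bigr => j _ /=.
by rewrite add_lfunE scale_lfunE scalerDl scalerA.
Qed.

HB.instance Definition _ :=
  GRing.isLinear.Build k (dual H) (dual H ⊗ dual H)%type _ (@dual_comul k H)
    dual_comul_linear.

Lemma tlift_dual_comul (U : lmodType k) (f : dual H -> dual H -> U) (p : dual H) :
  (forall q, linear (fun p => f p q)) -> (forall p, linear (f p)) ->
  tlift f (dual_comul p) =
    \sum_(i < \dim {:H}) \sum_(j < \dim {:H}) (p (e_ i * e_ j) : k) *: f
      (dual_coord i) (dual_coord j).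
Proof.
move=> f1 f2; rewrite linear_sum; apply: eq_bigr => i _.
rewrite linear_sum; apply: eq_bigr => j _.
by rewrite [LHS]linearZ /= tlift_tens.
Qed.

Lemma dual_coordE i (x : H) : (dual_coord i : dual H) x = coord (vbasis {:H}) i x.
Proof. by rewrite linfunE // => a u v; rewrite linearP. Qed.

Lemma sum_dual_coord (U : lmodType k) (g : H -> U) (x : H) : linear g ->
  \sum_(i < \dim {:H}) (((dual_coord i : dual H) x : k) *: g (e_ i)) = g x.
Proof.
move=> lg; pose g' : {linear H -> U} := HB.pack g
  (GRing.isLinear.Build _ _ _ _ _ lg).
rewrite [in RHS](coord_vbasis (memvf x)) -[RHS]/(g' _) linear_sum.
by apply: eq_bigr => i _; rewrite dual_coordE linearZ.
Qed.

(** The comultiplication of H^* transposes the product of H, so over the dual basis both sides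
    become the sum with coefficients p(e_i e_j e_l): associativity of H. *)
Lemma dual_comulA (U : lmodType k) (F : dual H -> dual H -> dual H -> U) p :
  (forall b c, linear (fun a => F a b c)) ->
  (forall a c, linear (fun b => F a b c)) ->
  (forall a b, linear (fun c => F a b c)) ->
  \ten_(a, y <- dual_comul p) \ten_(b, c <- dual_comul y) F a b c
    = \ten_(y, c <- dual_comul p) \ten_(a, b <- dual_comul y) F a b c.
Proof.
move=> F1 F2 F3; rewrite !tlift_dual_comul; [|lin..].
transitivity (\sum_(i < \dim {:H}) \sum_(j < \dim {:H}) \sum_(l < \dim {:H}) (p
  (e_ i * e_ j * e_ l) : k) *:
   F (dual_coord i) (dual_coord j) (dual_coord l)).
  apply: eq_bigr => i _.
  under eq_bigr => j _ do rewrite tlift_dual_comul // scaler_sumr.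
  rewrite exchange_big; apply: eq_bigr => a _.
  under eq_bigr => j _ do rewrite scaler_sumr.
  rewrite exchange_big; apply: eq_bigr => b _.
  (* Summing over [j] rebuilds e_a e_b from its coordinates. *)
  rewrite -mulrA -(sum_dual_coord (g := fun z => p (e_ i * z)) (e_ a * e_ b));
    last first.
    by move=> c u v; rewrite mulrDr -scalerAr linearP.
  by rewrite scaler_suml; apply: eq_bigr => j _; rewrite scalerA mulrC.
under [RHS]eq_bigr => i _ do under eq_bigr => j _ do
  [rewrite tlift_dual_comul // scaler_sumr;
   under eq_bigr => a _ do rewrite scaler_sumr].
under [RHS]eq_bigr => i _ do rewrite exchange_big.
rewrite [RHS]exchange_big; apply: eq_bigr => a _.
under [RHS]eq_bigr => i _ do rewrite exchange_big.
rewrite [RHS]exchange_big; apply: eq_bigr => b _.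
rewrite [RHS]exchange_big; apply: eq_bigr => c _.
rewrite -(sum_dual_coord (g := fun z => p (z * e_ c)) (e_ a * e_ b)); last first.
  by move=> d u v; rewrite mulrDl -scalerAl linearP.
by rewrite scaler_suml; apply: eq_bigr => j _; rewrite scalerA mulrC.
Qed.

Lemma dual_comul_counitr (p : dual H) :
  \ten_(a, b <- dual_comul p) (((b : dual H) 1 : k) *: a) = p.
Proof.
apply/lfunP => x; rewrite tlift_app -[in RHS](mulr1 x) -dual_comulE.
by apply: eq_tlift => a b; rewrite scale_lfunE mulrC.
Qed.

Lemma dual_comul_counitl (p : dual H) :
  \ten_(a, b <- dual_comul p) (((a : dual H) 1 : k) *: b) = p.
Proof.
apply/lfunP => x; rewrite tlift_app -[in RHS](mul1r x) -dual_comulE.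
by apply: eq_tlift => a b; rewrite scale_lfunE.
Qed.

Lemma double_comul_linear : linear (@double_comul k H).
Proof. by lin. Qed.

HB.instance Definition _ :=
  GRing.isLinear.Build k (drinfeld H) (drinfeld H ⊗ drinfeld H)%type _
    (@double_comul k H) double_comul_linear.

Lemma double_comul_tens (p : dual H) (h : H) :
  double_comul (p ⊗ h : drinfeld H) =
  \ten_(p1, p2 <- dual_comul p) \ten_(h1, h2 <- comul h)
    ((p2 ⊗ h1 : drinfeld H) ⊗ (p1 ⊗ h2 : drinfeld H)).
Proof. by rewrite /double_comul tlift_tens //; lin. Qed.

Lemma tlift_double_comul (U : lmodType k) (f : drinfeld H -> drinfeld H -> U) p h :
  (forall y, linear (fun x => f x y)) -> (forall x, linear (f x)) ->
  tlift f (double_comul (p ⊗ h : drinfeld H)) =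
  \ten_(p1, p2 <- dual_comul p) \ten_(h1, h2 <- comul h)
     f (p2 ⊗ h1) (p1 ⊗ h2).
Proof.
move=> f1 f2; rewrite double_comul_tens linear_tlift; apply: eq_tlift => p1 p2.
by rewrite linear_tlift; apply: eq_tlift => h1 h2 /=; rewrite tlift_tens.
Qed.

Lemma drinfeld_ext (U : lmodType k) (f g : drinfeld H -> U) :
  linear f -> linear g ->
  (forall (p : dual H) (h : H), f (p ⊗ h) = g (p ⊗ h)) -> f =1 g.
Proof.
move=> lf lg fg.
pose f' : {linear drinfeld H -> U} := HB.pack f
  (GRing.isLinear.Build _ _ _ _ _ lf).
pose g' : {linear drinfeld H -> U} := HB.pack g
  (GRing.isLinear.Build _ _ _ _ _ lg).
exact: (@tensor_ext _ _ _ _ f' g').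
Qed.

Lemma double_counit_linear : linear (@double_counit k H).
Proof. by move=> a u v; rewrite /double_counit linearP. Qed.

HB.instance Definition _ :=
  GRing.isLinear.Build k (drinfeld H) k^o _
    (@double_counit k H) double_counit_linear.

Lemma double_counit_tens (p : dual H) (h : H) :
  double_counit (p ⊗ h : drinfeld H) = p 1 * counit h.
Proof. by rewrite /double_counit tlift_tens //; lin. Qed.

Lemma double_comulA (x : drinfeld H) :
  \ten_(a, y <- double_comul x) \ten_(b, c <- double_comul y) (a ⊗ b ⊗ c)
    = \ten_(y, c <- double_comul x) \ten_(a, b <- double_comul y) (a ⊗ b ⊗ c).
Proof.
move: x; apply: drinfeld_ext => [||p h]; [lin.. |].
rewrite !tlift_double_comul; [|lin..].
(* The legs of [p] run backwards, as in H^*cop, so coassociativity of H^* is used from right to left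
   and that of H from left to right. *)
transitivity (\ten_(y, p3 <- dual_comul p) \ten_(p1, p2 <- dual_comul y)
   \ten_(h1, z <- comul h) \ten_(h2, h3 <- comul z)
     ((p3 ⊗ h1 : drinfeld H) ⊗ (p2 ⊗ h2 : drinfeld H) ⊗ (p1 ⊗ h3 : drinfeld H))).
  apply: eq_tlift => y p3; rewrite -[RHS]exchange_tlift.
  apply: eq_tlift => h1 z; rewrite tlift_double_comul //; lin.
rewrite -dual_comulA; [|lin..].
apply: eq_tlift => p1 y.
under eq_tlift => p2 p3.
  rewrite (coassoc_tlift (comulA h)); [|lin..].
  over.
rewrite exchange_tlift; apply: eq_tlift => z h3.
by rewrite tlift_double_comul //; lin.
Qed.

Lemma double_counitl (x : drinfeld H) :
  \ten_(a, b <- double_comul x) (double_counit (a : drinfeld H) *: (b :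
    drinfeld H)) = x.
Proof.
move: x; apply: drinfeld_ext => [||p h]; [lin.. |].
rewrite tlift_double_comul; [|lin..].
rewrite -[p in RHS]dual_comul_counitr -[h in RHS]counitl.
rewrite [RHS](linear_tlift_of (g := fun p => p ⊗ _)); last by lin.
apply: eq_tlift => p1 p2; rewrite (linear_tlift_of (g := fun h => _ ⊗ h)); last
  by lin.
apply: eq_tlift => h1 h2; rewrite double_counit_tens.
apply/matrixP => i j; rewrite !mxE !linearZ /=.
by rewrite -!mulrA; congr (_ * _); rewrite mulrCA.
Qed.

Lemma double_counitr (x : drinfeld H) :
  \ten_(a, b <- double_comul x) (double_counit (b : drinfeld H) *: (a :
    drinfeld H)) = x.
Proof.
move: x; apply: drinfeld_ext => [||p h]; [lin.. |].
rewrite tlift_double_comul; [|lin..].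
rewrite -[p in RHS]dual_comul_counitl -[h in RHS]counitr.
rewrite [RHS](linear_tlift_of (g := fun p => p ⊗ _)); last by lin.
apply: eq_tlift => p1 p2; rewrite (linear_tlift_of (g := fun h => _ ⊗ h)); last
  by lin.
apply: eq_tlift => h1 h2; rewrite double_counit_tens.
apply/matrixP => i j; rewrite !mxE !linearZ /=.
by rewrite -!mulrA; congr (_ * _); rewrite mulrCA.
Qed.

Definition double_coalg : coalg k.
Proof.
apply: (@Coalg k (drinfeld H) (@double_comul k H) (@double_counit k H)
  double_comul_linear double_counit_linear double_comulA double_counitl
  double_counitr).
by exists ((counit : dual H) ⊗ (1 : H)); rewrite double_counit_tens !counit1
  mulr1 oner_neq0.
Defined.

End DoubleCoalgebra.

(** * Bijectivity of the antipode *)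

Section BilinearConv.
Variables (k : fieldType) (C : coalg k) (R : falgType k).

Definition conv_fun2 (f : C -> C -> R) : conv C (conv C R) :=
  linfun (fun x => linfun (f x) : conv C R).

Lemma conv_fun2E (f : C -> C -> R) x y :
  (forall y, linear (fun x => f x y)) -> (forall x, linear (f x)) ->
  conv_fun2 f x y = f x y.
Proof.
move=> f1 f2; rewrite [conv_fun2 f x]linfunE ?linfunE //.
exact: linear_linfun.
Qed.

End BilinearConv.

Lemma conv2E (k : fieldType) (C D : coalg k) (R : falgType k)
  (f g : conv C (conv D R)) x y :
  (f * g) x y = \ten_(a, b <- cdelta x) \ten_(c, d <- cdelta y) (f a c * g b d).
Proof.
by rewrite convE tlift_app; apply: eq_tlift => a b; rewrite convE.
Qed.

Section Antipode.
Variables (k : fieldType) (H : hopfAlgType k).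
Local Notation Hc := (hopf_coalg H).
Local Notation S := (@antipode k H).

Definition comulcomp (R : falgType k) (f : conv Hc R) : conv Hc (conv Hc R) :=
  conv_fun2 (C := Hc) (fun x y : H => f (x * y)).

Section Comulcomp.
Variable R : falgType k.
Implicit Types f g : conv Hc R.

Lemma comulcompE f (x y : H) : comulcomp f x y = f (x * y).
Proof. by rewrite conv_fun2E //; lin. Qed.

(** The product H ⊗ H -> H is a coalgebra map, so composing with it preserves convolution. *)
Lemma comulcompM f g : comulcomp (f * g) = comulcomp f * comulcomp g.
Proof.
apply/lfunP => x; apply/lfunP => y; rewrite comulcompE conv2E convE.
rewrite [cdelta _](comulM x y) linear_tlift; apply: eq_tlift => a b.
rewrite linear_tlift; apply: eq_tlift => c d /=.
by rewrite tlift_tens ?comulcompE //; lin.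
Qed.

Lemma comulcomp1 : comulcomp 1 = 1 :> conv Hc (conv Hc R).
Proof.
apply/lfunP => x; apply/lfunP => y; rewrite comulcompE !conv1E scale_lfunE.
by rewrite conv1E /= counitM scalerA.
Qed.

Lemma comulcomp_linear : linear (@comulcomp R).
Proof.
move=> a f g; apply/lfunP => x; apply/lfunP => y.
by rewrite comulcompE !convD !convZ !comulcompE.
Qed.

End Comulcomp.

Definition conv_id : conv Hc H := \1%VF.
Definition conv_S : conv Hc H := S.

Lemma conv_Sid : conv_S * conv_id = 1.
Proof.
apply/lfunP => x; rewrite convE conv1E -antipodel.
by apply: eq_tlift => a b; rewrite id_lfunE.
Qed.

Lemma antipode1 : S 1 = 1.
Proof.
have := antipodel (1 : H); rewrite comul1 tlift_tens ?mulr1; [|lin..].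
by rewrite counit1 scale1r.
Qed.

(** In the convolution algebra of maps from H ⊗ H to H, the product of H has S ∘ mul as left inverse
    and [B] as right inverse, so the two agree. *)
Lemma antipodeM (x y : H) : S (x * y) = S y * S x.
Proof.
pose B : conv Hc (conv Hc H) :=
  conv_fun2 (C := Hc) (fun x y : H => S y * S x).
have BE (a b : H) : B a b = S b * S a by rewrite conv_fun2E //; lin.
suff -> : S (x * y) = comulcomp conv_S x y :> H.
  suff -> : comulcomp conv_S = B by [].
  rewrite -[LHS]mulr1; suff <- : comulcomp conv_id * B = 1.
    by rewrite mulrA -comulcompM conv_Sid comulcomp1 mul1r.
  apply/lfunP => a; apply/lfunP => b; rewrite conv2E !conv1E scale_lfunE conv1E.
  transitivity (\ten_(a1, a2 <- comul a) (a1 * (counit b : k)%:A * S a2)).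
    apply: eq_tlift => a1 a2; rewrite -antipoder mulr_tliftr mulr_tliftl.
    by apply: eq_tlift => b1 b2; rewrite BE comulcompE id_lfunE !mulrA.
  rewrite scalerA mulrC -scalerA -(antipoder a) linear_tlift.
  by apply: eq_tlift => a1 a2 /=; rewrite mulr_algr scalerAl.
by rewrite comulcompE.
Qed.

(* f ∘ S is the convolution inverse of f, which determines f. *)
Lemma morph_antipode_inj (R : falgType k) (f g : 'Hom(H, R)) :
  f 1 = 1 -> g 1 = 1 -> {morph f : x y / x * y} -> {morph g : x y / x * y} ->
  (forall x, f (S x) = g (S x)) -> f = g.
Proof.
move=> f1 g1 fM gM fg; apply/lfunP => x.
transitivity (\ten_(a, y <- comul x) \ten_(b, c <- comul y)
   (f a * g (S b) * g c)).
  rewrite -[in LHS](counitr x) linear_tlift; apply: eq_tlift => a y.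
  under eq_tlift => b c do rewrite -mulrA -gM.
  rewrite -mulr_tliftr -(linear_tlift g) antipodel !linearZ /= g1.
  by rewrite mulr_algr.
rewrite (coassoc_tlift (comulA x)); [|lin..].
rewrite -[in RHS](counitl x) linear_tlift; apply: eq_tlift => y c.
under eq_tlift => a b do rewrite -fg -fM.
by rewrite -mulr_tliftl -(linear_tlift f) antipoder !linearZ /= f1 mulr_algl.
Qed.

(* As [morph_antipode_inj], for the convolution over the opposite coalgebra. *)
Lemma antimorph_antipode_inj (R : falgType k) (f g : 'Hom(H, R)) :
  f 1 = 1 -> g 1 = 1 -> {morph f : x y / x * y >-> y * x} ->
  {morph g : x y / x * y >-> y * x} ->
  (forall x, f (S x) = g (S x)) -> f = g.
Proof.
move=> f1 g1 fM gM fg; apply/lfunP => x.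
transitivity (\ten_(a, y <- comul x) \ten_(b, c <- comul y)
   (g c * g (S b) * f a)).
  rewrite -[in LHS](counitr x) linear_tlift; apply: eq_tlift => a y.
  under eq_tlift => b c do rewrite -gM.
  rewrite -mulr_tliftl -(linear_tlift g) antipodel !linearZ /= g1.
  by rewrite mulr_algl.
rewrite (coassoc_tlift (comulA x)); [|lin..].
rewrite -[in RHS](counitl x) linear_tlift; apply: eq_tlift => y c.
under eq_tlift => a b do rewrite -fg -mulrA -fM.
by rewrite -mulr_tliftr -(linear_tlift f) antipoder !linearZ /= f1 mulr_algr.
Qed.

Lemma iter_antipode1 n : iter n S 1 = 1.
Proof. by elim: n => //= n ->; rewrite antipode1. Qed.

Lemma iter_antipodeM n x y : iter n S (x * y) =
  if odd n then iter n S y * iter n S x else iter n S x * iter n S y.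
Proof. by elim: n => //= n ->; case: (odd n) => /=; rewrite antipodeM. Qed.

Lemma iter_linear (V : vectType k) (f : 'End(V)) n : linear (iter n f).
Proof. by elim: n => // n IH a u v; rewrite /= IH linearP. Qed.

(** Each induction step cancels the innermost S from p ∘ S^(n+1) = S^(n+1). The maps p ∘ S^n and S^n
    are both multiplicative or both antimultiplicative, according to the parity of n, which selects
    the cancellation lemma. *)
Lemma hom_fix_iter_antipode (p : 'End(H)) n :
  p 1 = 1 -> {morph p : x y / x * y} ->
  (forall x, p (iter n S x) = iter n S x) -> forall x, p x = x.
Proof.
move=> p1 pM; elim: n => // n IH pS; apply: IH => x.
pose g : 'End(H) := linfun (iter n S); pose f : 'End(H) := (p \o g)%VF.
have gE y : g y = iter n S y by rewrite linfunE //; apply: iter_linear.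
have fE y : f y = p (iter n S y) by rewrite comp_lfunE gE.
rewrite -fE -gE; congr (fun_of_lfun _ x).
have fg y : f (S y) = g (S y) by rewrite fE gE -iterSr pS.
have g1 : g 1 = 1 by rewrite gE iter_antipode1.
have f1 : f 1 = 1 by rewrite fE iter_antipode1.
case on : (odd n).
  by apply: antimorph_antipode_inj => // a b; rewrite ?fE ?gE iter_antipodeM on ?pM.
by apply: morph_antipode_inj => // a b; rewrite ?fE ?gE iter_antipodeM on ?pM.
Qed.

End Antipode.

(** * Fitting decomposition for powers of an endomorphism *)

Section Fitting.
Import FalgLfun.
Variables (k : fieldType) (H : falgType k).

Lemma lfun_exprE (u : 'End(H)) n x : (u ^+ n) x = iter n u x.
Proof.
elim: n x => [|n IH] x; first by rewrite expr0 id_lfunE.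
by rewrite exprSr lfun_mulE IH.
Qed.

(** Taking one power more than the dimension of 'End(H) forces a linear dependence. Then some u^i
    lies in the span of the higher powers; factoring out u^(i+1) leaves a polynomial [q] in u. *)
Lemma strongly_regular_power (u : 'End(H)) : exists n, exists2 q : 'End(H),
  GRing.comm u q & u ^+ n = u ^+ n.+1 * q.
Proof.
pose N := (\dim {:'End(H)}).+1.
pose X := [tuple u ^+ (i : 'I_N) | i < N].
have XE (j : nat) : (j < N)%N -> X`_j = u ^+ j.
  by move=> jN; rewrite -[j]/(val (Ordinal jN)) -tnth_nth tnth_mktuple.
have : ~~ free X.
  rewrite /free; apply/eqP => E; have := dimvS (subvf <<X>>%VS).
  by rewrite E size_tuple ltnn.
rewrite freeNE => /existsP[i]; set Y := drop_tuple i.+1 X => uY.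
exists i; exists (\sum_(j < N - i.+1) coord Y j (X`_i) *: u ^+ j).
  apply: commr_sum => j _; rewrite /GRing.comm -scalerAr -scalerAl.
  by congr (_ *: _); apply: commrX.
rewrite -(XE i (ltn_ord i)) [LHS](coord_span uY) mulr_sumr.
apply: eq_bigr => j _; rewrite -scalerAr -exprD nth_drop; congr (_ *: _).
by rewrite [LHS]XE // -ltn_subRL.
Qed.

(** The exponent is even, so that this power of the antipode is multiplicative, and positive, so
    that its injectivity implies that of the antipode. *)
Lemma fitting_square (u : 'End(H)) : exists m, exists2 q : 'End(H),
  GRing.comm (u ^+ m.+1.*2) q & u ^+ m.+1.*2 = u ^+ m.+1.*2 * u ^+ m.+1.*2 * q.
Proof.
have [n [q cq un]] := strongly_regular_power u.
have E1 : u ^+ n.+1 = u ^+ n.+2 * q.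
  by rewrite exprS [in LHS]un mulrA -exprS.
have E2 j : u ^+ n.+1 = u ^+ (n.+1 + j) * q ^+ j.
  elim: j => [|j IH]; first by rewrite addn0 mulr1.
  have cqj : q * u ^+ j = u ^+ j * q by apply: commrX; apply: commr_sym.
  rewrite [LHS]IH exprD [X in X * _ * _]E1 -(mulrA _ q) cqj.
  by rewrite addnS -addSn exprD [q ^+ _.+1]exprS !mulrA.
exists n; exists (q ^+ n.+1.*2).
  apply: commrX; apply: commr_sym; apply: commrX; exact: commr_sym.
have [d dE] : {d | n.+1 + n.+1 = d}%N by exists (n.+1 + n.+1)%N.
rewrite -addnn dE -[in LHS]dE exprD [X in _ * X](E2 d).
by rewrite mulrA -exprD addnA dE exprD.
Qed.

End Fitting.

Section AntipodeBijective.
Variables (k : fieldType) (H : hopfAlgType k).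
Local Notation Hc := (hopf_coalg H).
Local Notation S := (@antipode k H).
Local Notation SV := (antipodeV H).

(* With T = S^n for an even n > 0 such that T = T^2 q and q commutes with T,
   the projection p = q T onto the image of T is multiplicative and fixes that
   image, so p = 1 by [hom_fix_iter_antipode] and T is injective. *)
Lemma antipode_inj : injective S.
Proof.
have [m [q]] := fitting_square S; set n := m.+1.*2 => cTq TE.
set T := (_ ^+ n)%R in cTq TE.
have TI x : T x = iter n S x by apply: lfun_exprE.
have on : odd n = false by rewrite odd_double.
have TM x y : T (x * y) = T x * T y by rewrite !TI iter_antipodeM on.
have T1 : T 1 = 1 by rewrite TI iter_antipode1.
have TTq x : q (T (T x)) = T x.
  by rewrite [in RHS]TE !FalgLfun.lfun_mulE.
have qT x : T (q x) = q (T x).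
  by rewrite -!FalgLfun.lfun_mulE cTq.
pose p : 'End(H) := (q \o T)%VF.
have pE x : p x = q (T x) by rewrite comp_lfunE.
have pS x : p (iter n S x) = iter n S x by rewrite pE -TI TTq.
have p1 : p 1 = 1 by rewrite -[in LHS]T1 TI pS -TI T1.
(* By T = T^2 q, both p(x y) and p(T(q x * q y)) equal q(T x * T y). As p fixes the image of T, the
   latter is T(q x) * T(q y), that is p x * p y. *)
have pM : {morph p : x y / x * y}.
  have TTq' z : T (T (q z)) = T z by rewrite !qT TTq.
  move=> x y; transitivity (p (T (q x * q y))).
    by rewrite !pE !TM !TTq'.
  by rewrite TI pS -TI TM !qT -!pE.
have pid := hom_fix_iter_antipode p1 pM pS.
suff Tinj : injective T.
  move=> x y Sxy; apply: Tinj; rewrite !TI /n doubleS !iterSr.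
  by rewrite Sxy.
by move=> x y Txy; rewrite -[x]pid -[y]pid !pE Txy.
Qed.

Lemma antipodeVK : cancel SV S.
Proof. by apply: lker0_lfunVK; apply/lker0P; apply: antipode_inj. Qed.

Lemma antipodeKV : cancel S SV.
Proof. by apply: lker0_lfunK; apply/lker0P; apply: antipode_inj. Qed.

Lemma antipodeV1 : SV 1 = 1.
Proof. by rewrite -[in LHS](antipode1 H) antipodeKV. Qed.

Lemma antipodeVl (h : H) :
  \ten_(h1, h2 <- comul h) (SV h2 * h1) = (counit h : k)%:A.
Proof.
apply: antipode_inj; rewrite linear_tlift !linearZ /= antipode1 -antipodel.
by apply: eq_tlift => a b; rewrite antipodeM antipodeVK.
Qed.

Lemma antipodeVr (h : H) :
  \ten_(h1, h2 <- comul h) (h2 * SV h1) = (counit h : k)%:A.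
Proof.
apply: antipode_inj; rewrite linear_tlift !linearZ /= antipode1 -antipoder.
by apply: eq_tlift => a b; rewrite antipodeM antipodeVK.
Qed.

Lemma counit_antipodeV (h : H) : counit (SV h) = counit h.
Proof.
have /(congr1 counit) := antipodeVl h; rewrite linear_tlift linearZ /= counit1.
rewrite [_ *: _]mulr1 => <-; rewrite -[in LHS](counitl h) !linear_tlift.
by apply: eq_tlift => a b; rewrite counitM !linearZ /= mulrC.
Qed.

End AntipodeBijective.

(** * Morphisms of convolution algebras *)

Section ConvMorphisms.
Variables (k : fieldType).

Section Cst.
Variables (C : coalg k) (R : falgType k).

(** When [R] is itself a convolution algebra this inserts a dummy first argument, turning f12 into
    f23; [conv_map] of it inserts a dummy second one, turning f12 into f13. *)
Definition cst (r : R) : conv C R := linfun (fun x => (ceps x : k) *: r).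

Lemma cstE r x : cst r x = (ceps x : k) *: r.
Proof. by rewrite linfunE //; lin. Qed.

Lemma mul_cst (f : conv C R) r x : (f * cst r) x = f x * r.
Proof.
rewrite convE -[in RHS](cepsr x) linear_tlift mulr_tliftl.
by apply: eq_tlift => a b /=; rewrite cstE linearZ /= -scalerAl -scalerAr.
Qed.

Lemma cst_mul (f : conv C R) r x : (cst r * f) x = r * f x.
Proof.
rewrite convE -[in RHS](cepsl x) linear_tlift mulr_tliftr.
by apply: eq_tlift => a b /=; rewrite cstE linearZ /= -scalerAl -scalerAr.
Qed.

Lemma cst_linear : linear cst.
Proof.
move=> a r r'; apply/lfunP => x.
by rewrite convD convZ !cstE scalerDr !scalerA mulrC.
Qed.

HB.instance Definition _ := GRing.isLinear.Build k R (conv C R) _ cst cst_linear.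

Lemma cst_monoid_morphism : monoid_morphism cst.
Proof.
split=> [|r r']; apply/lfunP => x; first by rewrite cstE.
by rewrite mul_cst !cstE -scalerAl.
Qed.

HB.instance Definition _ := GRing.isMonoidMorphism.Build R (conv C R) cst
  cst_monoid_morphism.

End Cst.

Section Map.
Variables (C : coalg k) (R R' : falgType k).

Definition conv_map (phi : R -> R') (f : conv C R) : conv C R' := linfun (fun x
  => phi (f x)).

Variable phi : {lrmorphism R -> R'}.

Lemma conv_mapE f x : conv_map phi f x = phi (f x).
Proof. by rewrite linfunE //; lin. Qed.

Lemma conv_map_linear : linear (conv_map phi).
Proof.
move=> a f g; apply/lfunP => x.
by rewrite convD convZ !conv_mapE convD convZ linearP.
Qed.

HB.instance Definition _ :=
  GRing.isLinear.Build k (conv C R) (conv C R') _ (conv_map phi) conv_map_linear.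

Lemma conv_map_monoid_morphism : monoid_morphism (conv_map phi).
Proof.
split=> [|f g]; apply/lfunP => x; rewrite conv_mapE.
  by rewrite !conv1E linearZ /= rmorph1.
rewrite !convE linear_tlift; apply: eq_tlift => a b.
by rewrite rmorphM /= !conv_mapE.
Qed.

HB.instance Definition _ :=
  GRing.isMonoidMorphism.Build (conv C R) (conv C R') (conv_map phi)
    conv_map_monoid_morphism.

End Map.

Section Pull.
Variables (H : hopfAlgType k).
Local Notation Hc := (hopf_coalg H).
Local Notation Dc := (double_coalg H).

HB.instance Definition _ (R : falgType k) :=
  GRing.isLinear.Build k (conv Hc R) (conv Hc (conv Hc R)) _
    (@comulcomp k H R) (@comulcomp_linear k H R).
HB.instance Definition _ (R : falgType k) :=
  GRing.isMonoidMorphism.Build (conv Hc R) (conv Hc (conv Hc R))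
    (@comulcomp k H R) (conj (comulcomp1 H R) (@comulcompM k H R)).

(* The coalgebra morphism ε ⊗ id; it is not multiplicative on the double. *)
Definition dproj : 'Hom(drinfeld H, H) :=
  linfun (fun x : drinfeld H => \ten_(p, h <- x) (((p : dual H) 1 : k) *: h)).

Lemma dprojE (p : dual H) (h : H) :
  dproj (p ⊗ h : drinfeld H) = (p 1 : k) *: h.
Proof. by rewrite linfunE ?tlift_tens //; lin. Qed.

Lemma counit_dproj (x : drinfeld H) : counit (dproj x) = double_counit x.
Proof.
move: x; apply: drinfeld_ext => [||p h]; [lin.. |].
by rewrite dprojE double_counit_tens linearZ.
Qed.

(** Since p |-> p(1) is the counit of H^*, [dproj] is comultiplicative; hence [pull] is an algebra
    morphism. *)
Lemma tlift_dproj (U : lmodType k) (f : H -> H -> U) (x : drinfeld H) :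
  (forall y, linear (fun x => f x y)) -> (forall x, linear (f x)) ->
  \ten_(a, b <- double_comul x) f (dproj a) (dproj b) = tlift f (comul (dproj x)).
Proof.
move=> f1 f2; move: x; apply: drinfeld_ext => [||p h]; [lin.. |].
rewrite tlift_double_comul; [|by move=> y; apply: (linear_comp (g := fun x => f
  x _)); lin
  |by move=> y; apply: (linear_comp (g := f _)); lin].
rewrite dprojE linearZ linearZ /= linear_tlift exchange_tlift.
apply: eq_tlift => a b /=.
rewrite -[p in RHS]dual_comul_counitr tlift_app scaler_tliftl.
apply: eq_tlift => p1 p2; rewrite !dprojE scale_lfunE.
by rewrite (linear_scaleE _ _ (f1 _)) (linear_scaleE _ _ (f2 _)) scalerA.
Qed.

Section PullR.
Variable R : falgType k.

Definition pull (f : conv Hc R) : conv Dc R :=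
  linfun (fun x : drinfeld H => f (dproj x)).

Lemma pullE f (x : drinfeld H) : pull f x = f (dproj x).
Proof. by rewrite linfunE //; lin. Qed.

Lemma pull_linear : linear pull.
Proof.
move=> a f g; apply/lfunP => x.
by rewrite convD convZ !pullE convD convZ.
Qed.

HB.instance Definition _ :=
  GRing.isLinear.Build k (conv Hc R) (conv Dc R) _ pull pull_linear.

Lemma pull_monoid_morphism : monoid_morphism pull.
Proof.
split=> [|f g]; apply/lfunP => x; rewrite pullE.
  by rewrite !conv1E /= counit_dproj.
rewrite !convE -[LHS]tlift_dproj; [|lin..].
by apply: eq_tlift => a b; rewrite !pullE.
Qed.

HB.instance Definition _ :=
  GRing.isMonoidMorphism.Build (conv Hc R) (conv Dc R) pull
    pull_monoid_morphism.

Lemma pull_cst r : pull (cst Hc r) = cst Dc r.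
Proof. by apply/lfunP => x; rewrite pullE !cstE /= counit_dproj. Qed.

Definition dual_eval (u : H) : conv Dc R :=
  linfun (fun x : drinfeld H =>
    \ten_(q, l <- x) (((q : dual H) u * counit l : k)%:A)).

Lemma dual_evalE u (q : dual H) (l : H) :
  dual_eval u (q ⊗ l : drinfeld H) = (q u * counit l : k)%:A.
Proof. by rewrite linfunE ?tlift_tens //; lin. Qed.

Lemma dual_eval_linear : linear dual_eval.
Proof.
move=> a u v; apply/lfunP; apply: drinfeld_ext => [||q l]; [lin.. |].
rewrite convD convZ !dual_evalE linearP mulrDl scalerDl scalerA.
by rewrite -mulrA.
Qed.

HB.instance Definition _ :=
  GRing.isLinear.Build k H (conv Dc R) _ dual_eval dual_eval_linear.

(** One factor depends only on the H^* part of the tensor product coalgebra and the other only on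
    the H part, so the convolution product separates. The reverse order gives the same value, whence
    [comm_dual_eval_pull]. *)
Lemma dual_eval_pull u f (q : dual H) (l : H) :
  (dual_eval u * pull f) (q ⊗ l : drinfeld H) = (q u : k) *: f l.
Proof.
rewrite convE [LHS]tlift_double_comul; [|lin..].
rewrite -[in RHS](dual_comul_counitl q) tlift_app.
rewrite scaler_tliftl.
apply: eq_tlift => q1 q2; rewrite scale_lfunE -[in RHS](counitl l) linear_tlift
  scaler_tlift.
apply: eq_tlift => l1 l2; rewrite dual_evalE pullE dprojE !linearZ /= mulr_algl.
rewrite !scalerA; congr (_ *: _).
by rewrite [RHS]mulrC [LHS]mulrAC [X in X * _]mulrC.
Qed.

Lemma pull_dual_eval u f (q : dual H) (l : H) :
  (pull f * dual_eval u) (q ⊗ l : drinfeld H) = (q u : k) *: f l.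
Proof.
rewrite convE [LHS]tlift_double_comul; [|lin..].
rewrite -[in RHS](dual_comul_counitr q) tlift_app.
rewrite scaler_tliftl.
apply: eq_tlift => q1 q2; rewrite scale_lfunE -[in RHS](counitr l) linear_tlift
  scaler_tlift.
apply: eq_tlift => l1 l2; rewrite dual_evalE pullE dprojE !linearZ /= mulr_algr.
rewrite !scalerA; congr (_ *: _).
by rewrite [RHS]mulrC [LHS]mulrAC [X in X * _]mulrC.
Qed.

Lemma comm_dual_eval_pull u f : GRing.comm (dual_eval u) (pull f).
Proof.
apply/lfunP; apply: drinfeld_ext => [||q l]; [lin.. |].
by rewrite dual_eval_pull pull_dual_eval.
Qed.

Lemma comm_dual_eval_cst u r : GRing.comm (dual_eval u) (cst Dc r).
Proof. by rewrite -pull_cst; apply: comm_dual_eval_pull. Qed.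

Lemma dual_eval1 : dual_eval 1 = 1.
Proof.
apply/lfunP; apply: drinfeld_ext => [||q l]; [lin.. |].
by rewrite dual_evalE conv1E /= double_counit_tens.
Qed.

(** The order is reversed because the coalgebra is H^*cop. *)
Lemma dual_evalM u v : dual_eval (u * v) = dual_eval v * dual_eval u.
Proof.
apply/lfunP; apply: drinfeld_ext => [||q l]; [lin.. |].
rewrite convE [RHS]tlift_double_comul; [|lin..].
rewrite dual_evalE -dual_comulE mulr_tliftl -[in LHS](counitl l).
rewrite scaler_tliftl.
apply: eq_tlift => q1 q2; rewrite !linear_tlift.
rewrite mulr_tliftr scaler_tliftl.
apply: eq_tlift => l1 l2; rewrite !dual_evalE mulr_algl scalerA linearZ /=.
by congr (_ *: _); rewrite [RHS]mulrACA; congr (_ * _); rewrite mulrC.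
Qed.

End PullR.
End Pull.
End ConvMorphisms.

(** * The twisting cochain *)

Lemma linear_tlift3 (k : fieldType) (V : vectType k) (U T : lmodType k)
    (g : U -> T) (D : V -> (V ⊗ V)%type) (F : V -> V -> V -> U) x :
  linear g -> g (\ten3_(a, b, c <- x | D) F a b c) =
    \ten3_(a, b, c <- x | D) g (F a b c).
Proof.
move=> lg; rewrite /tlift3 (linear_tlift_of _ _ lg); apply: eq_tlift => a y.
by rewrite (linear_tlift_of _ _ lg).
Qed.

Lemma eq_tlift3 (k : fieldType) (V : vectType k) (U : lmodType k)
    (D : V -> (V ⊗ V)%type) (F G : V -> V -> V -> U) x :
  (forall a b c, F a b c = G a b c) -> 
  \ten3_(a, b, c <- x | D) F a b c = \ten3_(a, b, c <- x | D) G a b c.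
Proof. by move=> FG; apply: eq_tlift => a y; apply: eq_tlift => b c. Qed.

Lemma exchange_tlift3_tlift (k : fieldType) (V W W' : vectType k) (U : lmodType k)
    (D : V -> (V ⊗ V)%type) (x : V) (t : (W ⊗ W')%type)
    (F : V -> V -> V -> W -> W' -> U) :
  \ten3_(a, b, c <- x | D) \ten_(d, e <- t) F a b c d e =
  \ten_(d, e <- t) \ten3_(a, b, c <- x | D) F a b c d e.
Proof.
rewrite -[RHS]exchange_tlift; apply: eq_tlift => a y.
exact: exchange_tlift.
Qed.

Lemma exchange_tlift3 (k : fieldType) (V W : vectType k) (U : lmodType k)
    (D : V -> (V ⊗ V)%type) (E : W -> (W ⊗ W)%type) (x : V) (z : W)
    (F : V -> V -> V -> W -> W -> W -> U) :
  \ten3_(a, b, c <- x | D) \ten3_(d, e, f <- z | E) F a b c d e f =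
  \ten3_(d, e, f <- z | E) \ten3_(a, b, c <- x | D) F a b c d e f.
Proof.
rewrite exchange_tlift3_tlift; apply: eq_tlift => d y.
exact: exchange_tlift3_tlift.
Qed.

Lemma conv3E (k : fieldType) (C : coalg k) (R : falgType k) (f g h : conv C R) x :
  (f * g * h) x = \ten3_(a, b, c <- x | @cdelta k C) (f a * g b * h c).
Proof.
rewrite -mulrA convE; apply: eq_tlift => a y.
by rewrite convE mulr_tliftr; apply: eq_tlift => b c; rewrite mulrA.
Qed.

Section Conjugation.
Variable R : unitRingType.
Implicit Types g x y : R.

Definition conjr g x : R := g * x / g.

Lemma conjrM g x y : g \is a GRing.unit -> conjr g (x * y) = conjr g x * conjr g y.
Proof. by move=> gu; rewrite /conjr !mulrA mulrVK. Qed.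

Lemma conjr_mul g h x : g \is a GRing.unit -> h \is a GRing.unit ->
  conjr (g * h) x = conjr g (conjr h x).
Proof. by move=> gu hu; rewrite /conjr invrM // !mulrA. Qed.

Lemma conjr_id g x : g \is a GRing.unit -> GRing.comm g x -> conjr g x = x.
Proof. by move=> gu gx; rewrite /conjr gx mulrK. Qed.

Lemma conjr_comm g x y : g \is a GRing.unit -> GRing.comm x y ->
  GRing.comm (conjr g x) (conjr g y).
Proof. by move=> gu xy; rewrite /GRing.comm -!conjrM // xy. Qed.

Lemma inverse_unit x y : x * y = 1 -> y * x = 1 ->
  x \is a GRing.unit /\ x^-1 = y.
Proof.
move=> xy yx; have xu : x \is a GRing.unit by apply/unitrP; exists y.
by split=> //; rewrite -[y](mulKr xu) xy mulr1.
Qed.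

End Conjugation.

Lemma rmorph_conjr (R R' : unitRingType) (f : {rmorphism R -> R'}) g x :
  g \is a GRing.unit -> f (conjr g x) = conjr (f g) (f x).
Proof. by move=> gu; rewrite /conjr !rmorphM rmorphV. Qed.


Section Twist.
Variables (k : fieldType) (H : hopfAlgType k).
Local Notation Hc := (hopf_coalg H).
Local Notation Dc := (double_coalg H).
Local Notation SV := (antipodeV H).

(** An antimultiplicative map merges a(h1) a(S^-1(h2)) into a(S^-1(h2) h1), and S^-1 satisfies the
    antipode identities of the opposite coalgebra. *)
Lemma antihom_inverse (R : falgType k) (a : conv Hc R) :
  a (1 : H) = 1 -> (forall x y : H, a (x * y) = a y * a x) ->
  a \is a GRing.unit /\ forall h : H, (a^-1) h = a (SV h).
Proof.
move=> a1 aM; pose b : conv Hc R := linfun (fun h : H => a (SV h)).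
have bE (h : H) : b h = a (SV h) by rewrite linfunE //; lin.
have [|| au ->] // := @inverse_unit _ a b.
- apply/lfunP => h; rewrite convE conv1E.
  under eq_tlift => x y do rewrite bE -aM.
  by rewrite -(linear_tlift a) antipodeVl linearZ /= a1.
- apply/lfunP => h; rewrite convE conv1E.
  under eq_tlift => x y do rewrite bE -aM.
  by rewrite -(linear_tlift a) antipodeVr linearZ /= a1.
Qed.

Section TwistR.
Variable R : falgType k.

(* W of the header as a map from H; W itself is [pull dual_twist]. *)
Definition dual_twist : conv Hc (conv Dc R) := linfun (@dual_eval k H R).

Lemma dual_twistE (h : H) : dual_twist h = dual_eval R h.
Proof. by rewrite linfunE //; lin. Qed.

Lemma dual_twist1 : dual_twist (1 : H) = 1.
Proof. by rewrite dual_twistE dual_eval1. Qed.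

Lemma dual_twistM (x y : H) : dual_twist (x * y) = dual_twist y * dual_twist x.
Proof. by rewrite !dual_twistE dual_evalM. Qed.

Lemma dual_twist_unit : dual_twist \is a GRing.unit.
Proof. by have [] := antihom_inverse dual_twist1 dual_twistM. Qed.

Lemma dual_twistVE (h : H) : dual_twist^-1 h = dual_eval R (SV h).
Proof. by have [_ ->] := antihom_inverse dual_twist1 dual_twistM; rewrite
  dual_twistE. Qed.

(** The case u = 1 gives sigma_bar. A general [u] is needed for the product of D, whose H^* part
    evaluates at x to p(x1) q(S^-1(h3) x2 h1). *)
Lemma conjr_dual_twistE (u : H) (f : conv Hc (conv Hc R)) (h : H) (q : dual H)
  (l : H) :
  (conjr dual_twist (cst Hc (dual_eval R u) * conv_map (@pull k H R) f)) h (q ⊗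
    l : drinfeld H) =
  \ten3_(h1, h2, h3 <- h | comul) ((q (SV h3 * (u * h1)) : k) *: f h2 l).
Proof.
rewrite /conjr conv3E (linear_tlift3 (g := fun F : conv Dc R => F _)); last by lin.
apply: eq_tlift3 => h1 h2 h3.
rewrite dual_twistE dual_twistVE cst_mul conv_mapE mulrA -dual_evalM -mulrA.
by rewrite -(comm_dual_eval_pull (SV h3)) mulrA -dual_evalM dual_eval_pull.
Qed.

Definition twist (f : conv Hc (conv Hc R)) : conv Dc (conv Dc R) :=
  conjr (pull dual_twist) (pull (conv_map (@pull k H R) f)).

Lemma twist_pull f : twist f = pull (conjr dual_twist (conv_map (@pull k H R) f)).
Proof. by rewrite (rmorph_conjr (@pull k H _)) ?dual_twist_unit. Qed.

Lemma twistE f (p q : dual H) (h l : H) :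
  twist f (p ⊗ h : drinfeld H) (q ⊗ l : drinfeld H) =
  (p 1 : k) *: \ten3_(h1, h2, h3 <- h | comul) ((q (SV h3 * h1) : k) *: f h2 l).
Proof.
rewrite twist_pull pullE dprojE linearZ convZ; congr (_ *: _).
have := conjr_dual_twistE 1 f h q l; rewrite dual_eval1 rmorph1 mul1r => ->.
by apply: eq_tlift3 => h1 h2 h3; rewrite mul1r.
Qed.

End TwistR.

Lemma double_mul_linearl (y : drinfeld H) :
  linear (fun x : drinfeld H => double_mul x y).
Proof. by rewrite /double_mul; lin. Qed.

Lemma double_mul_linearr (x : drinfeld H) : linear (double_mul x).
Proof. by rewrite /double_mul; lin. Qed.

Lemma double_mul_tens (p q : dual H) (h l : H) :
  double_mul (p ⊗ h : drinfeld H) (q ⊗ l : drinfeld H) =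
  \ten3_(h1, h2, h3 <- h | comul)
    (dual_mul p (lact h1 (ract q (SV h3))) ⊗ (h2 * l)).
Proof.
rewrite /double_mul tlift_tens; [|rewrite /dual_mul /lact /ract; lin..].
by rewrite tlift_tens //; rewrite /dual_mul /lact /ract; lin.
Qed.

Lemma act_dual_mulE (p q : dual H) (u v x : H) :
  dual_mul p (lact u (ract q v)) x =
  \ten_(a, b <- comul x) (p a * q (v * (b * u))).
Proof. by rewrite dual_mulE; apply: eq_tlift => a b; rewrite lactE ractE. Qed.

End Twist.

(** * Evaluation of twisted cochains *)

Section Pull2.
Variables (k : fieldType) (H : hopfAlgType k).
Local Notation Hc := (hopf_coalg H).
Local Notation Dc := (double_coalg H).

Definition pull2 (R : falgType k) (f : conv Hc (conv Hc R)) :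
  conv Dc (conv Dc R) := pull (conv_map (@pull k H R) f).

Definition pull3 (R : falgType k) (f : conv Hc (conv Hc (conv Hc R))) :
  conv Dc (conv Dc (conv Dc R)) := pull (conv_map (@pull2 R) f).

HB.instance Definition _ R := GRing.LRMorphism.copy (@pull2 R)
  (@pull k H _ \o conv_map (@pull k H R)).

HB.instance Definition _ R := GRing.LRMorphism.copy (@pull3 R)
  (@pull k H _ \o conv_map (@pull2 R)).

Lemma pull2E R (f : conv Hc (conv Hc R)) (x y : drinfeld H) :
  pull2 f x y = f (dproj H x) (dproj H y).
Proof. by rewrite pullE conv_mapE pullE. Qed.

Lemma pull3E R (f : conv Hc (conv Hc (conv Hc R))) (x y z : drinfeld H) :
  pull3 f x y z = f (dproj H x) (dproj H y) (dproj H z).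
Proof. by rewrite pullE conv_mapE pull2E. Qed.

End Pull2.

Lemma conjr_cst (k : fieldType) (C : coalg k) (R : falgType k) (w : R)
    (f : conv C R) x :
  w \is a GRing.unit -> conjr (cst C w) f x = conjr w (f x).
Proof. by move=> wu; rewrite /conjr -rmorphV // mul_cst cst_mul. Qed.

Lemma linear_conjr (k : fieldType) (R : falgType k) (w : R) : linear (conjr w).
Proof. by rewrite /conjr; lin. Qed.


Lemma scalar_inj (k : fieldType) (R : falgType k) (a b : k) :
  a%:A = b%:A :> R -> a = b.
Proof.
move/eqP; rewrite -subr_eq0 -scalerBl scaler_eq0 oner_eq0 orbF subr_eq0.
by move/eqP.
Qed.

(** * The conditions on cochains as equations in iterated convolution algebras *)

Section Cochains.
Variables (k : fieldType) (C : coalg k).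
Implicit Types (R : falgType k) (s t : 'Hom((C ⊗ C)%type, k^o)).

(** The values are scalars of an arbitrary [R], so that the same formula gives s12 in the presence
    of later arguments. *)
Definition cochain s R : conv C (conv C R) :=
  conv_fun2 (fun x y => (s (x ⊗ y) : k)%:A).

Lemma cochainE s R x y : cochain s R x y = (s (x ⊗ y) : k)%:A.
Proof. by rewrite conv_fun2E //; lin. Qed.

Lemma cochain_mulE s t R x y : (cochain s R * cochain t R) x y =
  (\ten_(x1, x2 <- cdelta x) \ten_(y1, y2 <- cdelta y)
     (s (x1 ⊗ y1) * t (x2 ⊗ y2)) : k)%:A.
Proof.
rewrite conv2E scaler_tliftl; apply: eq_tlift => x1 x2.
rewrite scaler_tliftl; apply: eq_tlift => y1 y2.
by rewrite !cochainE mulr_algl scalerA.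
Qed.

(** Together with [mul_cst_cochain], this shows that neatness of s says that s12 and s23 commute. *)
Lemma mul_cochain_cst s t R x y z :
  (cochain s (conv C R) * cst C (cochain t R)) x y z =
  (\ten_(y1, y2 <- cdelta y) (s (x ⊗ y1) * t (y2 ⊗ z)) : k)%:A.
Proof.
rewrite mul_cst convE tlift_app scaler_tliftl; apply: eq_tlift => y1 y2.
by rewrite cochainE mulr_algl convZ cochainE scalerA.
Qed.

Lemma mul_cst_cochain s t R x y z :
  (cst C (cochain t R) * cochain s (conv C R)) x y z =
  (\ten_(y1, y2 <- cdelta y) (t (y1 ⊗ z) * s (x ⊗ y2)) : k)%:A.
Proof.
rewrite cst_mul convE tlift_app scaler_tliftl; apply: eq_tlift => y1 y2.
by rewrite cochainE mulr_algr convZ cochainE scalerA mulrC.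
Qed.

Section Cocycle.
Variables (R : falgType k) (f g : conv C (conv C (conv C R))).
Variable phi : C -> C -> C -> k.
Hypothesis fE : forall x y z, f x y z = (phi x y z)%:A.

(** The value [phi] of [f] is left abstract so as to cover both H, where [f] is a composite with the
    product, and D, where [f] is a conjugate known through its values. *)
Lemma cochain_mul3E s x y z :
  (cochain s (conv C R) * f) x y z =
  (\ten_(x1, x2 <- cdelta x) \ten_(y1, y2 <- cdelta y)
     (s (x1 ⊗ y1) * phi x2 y2 z : k^o) : k)%:A.
Proof.
rewrite convE !tlift_app scaler_tliftl; apply: eq_tlift => x1 x2.
rewrite convE tlift_app scaler_tliftl; apply: eq_tlift => y1 y2.
by rewrite cochainE mulr_algl convZ fE scalerA.
Qed.

Lemma cst_cochain_mul3E s x y z :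
  (cst C (cochain s R) * f) x y z =
  (\ten_(y1, y2 <- cdelta y) \ten_(z1, z2 <- cdelta z)
     (s (y1 ⊗ z1) * phi x y2 z2 : k^o) : k)%:A.
Proof.
rewrite cst_mul conv2E scaler_tliftl; apply: eq_tlift => y1 y2.
rewrite scaler_tliftl; apply: eq_tlift => z1 z2.
by rewrite cochainE mulr_algl fE scalerA.
Qed.

End Cocycle.

Section Pure.
Variables (R : falgType k) (f : conv C (conv C (conv C (conv C R)))).
Variables (g : conv C (conv C (conv C R))) (phi psi : C -> C -> C -> k).
Hypothesis fE : forall x y z, f x y z = (phi x y z)%:A.
Hypothesis gE : forall x y z, g x y z = (psi x y z)%:A.

Lemma pure_mulE s w x y z :
  (f * cst C (cochain s (conv C R)) * cst C g) w x y z =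
  (\ten3_(x1, x2, x3 <- x | @cdelta k C) \ten3_(y1, y2, y3 <- y | @cdelta k C)
     (phi w x1 y1 * s (x2 ⊗ y2) * psi x3 y3 z : k^o) : k)%:A.
Proof.
rewrite (mul_cst (f * cst C (cochain s (conv C R))) g w).
rewrite (mul_cst f (cochain s (conv C R)) w) conv3E (linear_tlift3 (g := fun F
  : conv C (conv C R) => F y z));
  last by lin.
rewrite (linear_tlift3 (g := fun x : k^o => (x : k)%:A : R)); last by lin.
apply: eq_tlift3 => x1 x2 x3.
rewrite conv3E (linear_tlift3 (g := fun F : conv C R => F z)); last by lin.
rewrite (linear_tlift3 (g := fun x : k^o => (x : k)%:A : R)); last by lin.
apply: eq_tlift3 => y1 y2 y3.
by rewrite cochainE fE mulr_algl -scalerAl mulr_algl !convZ gE !scalerA.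
Qed.

Lemma pure_mulE_rev s w x y z :
  (cst C g * cst C (cochain s (conv C R)) * f) w x y z =
  (\ten3_(x1, x2, x3 <- x | @cdelta k C) \ten3_(y1, y2, y3 <- y | @cdelta k C)
     (psi x1 y1 z * s (x2 ⊗ y2) * phi w x3 y3 : k^o) : k)%:A.
Proof.
rewrite -mulrA (cst_mul (cst C (cochain s (conv C R)) * f) g w).
rewrite (cst_mul f (cochain s (conv C R)) w) mulrA conv3E (linear_tlift3 (g :=
  fun F : conv C (conv C R) => F y z));
  last by lin.
rewrite (linear_tlift3 (g := fun x : k^o => (x : k)%:A : R)); last by lin.
apply: eq_tlift3 => x1 x2 x3.
rewrite conv3E (linear_tlift3 (g := fun F : conv C R => F z)); last by lin.
rewrite (linear_tlift3 (g := fun x : k^o => (x : k)%:A : R)); last by lin.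
apply: eq_tlift3 => y1 y2 y3.
rewrite cochainE fE !mulr_algr !convZ gE !scalerA.
by congr (_ *: _); rewrite [LHS]mulrC [X in _ * X = _]mulrC mulrA.
Qed.

(** Here [f] lives on arguments 1, 2, 3, the cochain of [s] on 2, 3 and [g] on 2, 3, 4. With [s] the
    inverse of the cocycle, the right-hand condition is purity. *)
Lemma pure_commE s :
  f * cst C (cochain s (conv C R)) * cst C g =
    cst C g * cst C (cochain s (conv C R)) * f <->
  forall w x y z,
  (\ten3_(x1, x2, x3 <- x | @cdelta k C) \ten3_(y1, y2, y3 <- y | @cdelta k C)
     (phi w x1 y1 * s (x2 ⊗ y2) * psi x3 y3 z : k^o)) =
  (\ten3_(x1, x2, x3 <- x | @cdelta k C) \ten3_(y1, y2, y3 <- y | @cdelta k C)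
     (psi x1 y1 z * s (x2 ⊗ y2) * phi w x3 y3 : k^o)).
Proof.
split=> [E w x y z | E].
  have := pure_mulE s w x y z; rewrite E pure_mulE_rev.
  by move/scalar_inj => ->.
apply/lfunP => w; apply/lfunP => x; apply/lfunP => y; apply/lfunP => z.
by rewrite pure_mulE pure_mulE_rev E.
Qed.

End Pure.

End Cochains.

Section Evaluation.
Variables (k : fieldType) (H : hopfAlgType k).
Variable sigma : 'Hom((H ⊗ H)%type, k^o).
Local Notation Hc := (hopf_coalg H).
Local Notation Dc := (double_coalg H).
Local Notation SV := (antipodeV H).

Section EvaluationR.
Variable R : falgType k.
Local Notation R1 := (conv Dc R).
Local Notation sg := (cochain (C := Hc) sigma R).
Local Notation dual_twist := (dual_twist H).

Lemma twist_cochainE (x y : drinfeld H) :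
  twist sg x y = (sigma_bar sigma (x ⊗ y) : k)%:A.
Proof.
move: x; apply: drinfeld_ext => [||p h]; [lin..|].
move: y; apply: drinfeld_ext => [||q l]; [lin..|].
rewrite twistE sigma_barE (linear_tlift3 (g := fun x : R => _ *: x)); last by lin.
rewrite (linear_tlift3 (g := fun x : k^o => (x : k)%:A)); last by lin.
by apply: eq_tlift3 => h1 h2 h3; rewrite cochainE !scalerA.
Qed.

(** sigma_bar sees its first argument only through [dproj]; this version takes that argument in H,
    where [comulcomp] applies. *)
Definition twisted_cochain : conv Hc R1 := conjr (dual_twist R) (conv_map
  (@pull k H R) sg).

Lemma twisted_cochainE (p : dual H) (g : H) (z : drinfeld H) :
  (sigma_bar sigma ((p ⊗ g : drinfeld H) ⊗ z) : k)%:A = (p 1 : k) *: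
    twisted_cochain g z.
Proof.
by rewrite -twist_cochainE twist_pull pullE dprojE linearZ convZ.
Qed.

(** Applying [dproj] to the product (p ⊗ h)(q ⊗ l) leaves p(1) q(S^-1(h3) h1) h2 l, which is the
    product of H conjugated by W. *)
Lemma twist_comulcompE (x y z : drinfeld H) :
  twist (comulcomp twisted_cochain) x y z = (sigma_bar sigma (double_mul x y ⊗
    z) : k)%:A.
Proof.
have lml := @double_mul_linearl k H; have lmr := @double_mul_linearr k H.
have lin1 (y' : drinfeld H) :
  linear (fun x : drinfeld H =>
    (sigma_bar sigma (double_mul x y' ⊗ z) : k)%:A : R) by lin.
have lin2 (x' : drinfeld H) :
  linear (fun y : drinfeld H =>
    (sigma_bar sigma (double_mul x' y ⊗ z) : k)%:A : R) by lin.
move: x; apply: drinfeld_ext => [||p h]; [lin| exact: lin1 |].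
move: y {lin1}; apply: drinfeld_ext => [||q l]; [lin| exact: lin2 |].
rewrite twistE convZ double_mul_tens.
rewrite (linear_tlift3 (g := fun F : R1 => F z)); last by lin.
rewrite (linear_tlift3 (g := fun x : drinfeld H =>
  (sigma_bar sigma (x ⊗ z) : k)%:A : R)); last by lin.
rewrite (linear_tlift3 (g := fun x : R => _ *: x)); last by lin.
apply: eq_tlift3 => h1 h2 h3; rewrite twisted_cochainE comulcompE convZ
  act_dual_mulE.
by rewrite comul1 tlift_tens ?mul1r ?scalerA //; lin.
Qed.

(* W12 W13 as a map of the first argument. *)
Definition dual_twist2 : conv Hc (conv Dc R1) :=
  dual_twist R1 * conv_map (@cst k Dc R1) (dual_twist R).

Lemma dual_twist2E (h : H) :
  dual_twist2 h = \ten_(a, b <- comul h) (dual_eval R1 a * cst Dc (dual_eval R b)).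
Proof.
by rewrite convE; apply: eq_tlift => a b; rewrite conv_mapE !dual_twistE.
Qed.

Lemma dual_twist2_1 : dual_twist2 (1 : H) = 1.
Proof.
by rewrite dual_twist2E comul1 tlift_tens ?dual_eval1 ?rmorph1 ?mulr1 //; lin.
Qed.

Lemma dual_twist2M (x y : H) : dual_twist2 (x * y) = dual_twist2 y * dual_twist2 x.
Proof.
rewrite !dual_twist2E comulM linear_tlift mulr_tliftr; apply: eq_tlift => x1 x2.
rewrite linear_tlift mulr_tliftl; apply: eq_tlift => y1 y2.
rewrite /= tlift_tens; [|lin..].
rewrite !dual_evalM (rmorphM (@cst k Dc R1)) -!mulrA; congr (_ * _).
by rewrite !(mulrA _ _ (cst Dc (dual_eval R x2))) -(comm_dual_eval_cst x1).
Qed.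

Lemma dual_twist2_unit : dual_twist2 \is a GRing.unit.
Proof. by have [] := antihom_inverse dual_twist2_1 dual_twist2M. Qed.

Lemma dual_twist2VE (h : H) : dual_twist2^-1 h = dual_twist2 (SV h).
Proof. by have [_ ->] := antihom_inverse dual_twist2_1 dual_twist2M. Qed.

(** The left side uses only the H^* parts of its two arguments, the right side only their H
    parts. *)
Lemma comm_dual_twist2_pull2 (u : H) (f : conv Hc (conv Hc R)) :
  GRing.comm (dual_twist2 u) (pull2 f).
Proof.
rewrite /GRing.comm dual_twist2E mulr_tliftl mulr_tliftr; apply: eq_tlift => a b.
have c1 : GRing.comm (dual_eval R1 a) (pull2 f) by apply: comm_dual_eval_pull.
have c2 : GRing.comm (cst Dc (dual_eval R b)) (pull2 f).
  apply/lfunP => x; rewrite cst_mul mul_cst /pull2 pullE conv_mapE.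
  exact: comm_dual_eval_pull.
by rewrite -mulrA c2 !mulrA c1.
Qed.

Definition zcochain : conv Hc (conv Hc (conv Hc R)) :=
  conv_map (@comulcomp k H R) sg.

Lemma conjr_dual_twist2E (f : conv Hc (conv Hc (conv Hc R))) (h : H) :
  conjr dual_twist2 (conv_map (@pull2 k H R) f) h =
  \ten3_(h1, h2, h3 <- h | comul)
     \ten_(a, b <- comul (SV h3 * h1))
       (dual_eval R1 a * (cst Dc (dual_eval R b) * pull2 (f h2))).
Proof.
rewrite /conjr conv3E; apply: eq_tlift3 => h1 h2 h3.
rewrite dual_twist2VE conv_mapE -mulrA -(comm_dual_twist2_pull2 (SV h3)) mulrA
  -dual_twist2M dual_twist2E.
by rewrite mulr_tliftl; apply: eq_tlift => a b; rewrite mulrA.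
Qed.

Lemma conjr_dual_evalE (a b : H) (f : conv Hc (conv Hc R)) (q r : dual H) (l m
  : H) :
  conjr (pull (dual_twist R)) (dual_eval R1 a * (cst Dc (dual_eval R b) * pull2 f))
    (q ⊗ l : drinfeld H) (r ⊗ m : drinfeld H) =
  (q a : k) *: \ten3_(l1, l2, l3 <- l | comul)
     ((r (SV l3 * (b * l1)) : k) *: f l2 m).
Proof.
have wu : pull (dual_twist R) \is a GRing.unit by apply: rmorph_unit; apply:
  dual_twist_unit.
rewrite conjrM // (conjr_id wu); last by apply: commr_sym; apply:
  comm_dual_eval_pull.
rewrite -pull_cst -(rmorphM (@pull k H _)) -(rmorph_conjr (@pull k H _))
  ?dual_twist_unit //.
by rewrite dual_eval_pull convZ conjr_dual_twistE.
Qed.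

(** Conjugation by W12 W13 evaluates q and r at the two legs a, b of S^-1(h3) h1; conjugation by W23
    then turns r(b) into r(S^-1(l3) b l1). This is how q and r enter the product of y and z. *)
Lemma conjr_zcochainE (x y z : drinfeld H) :
  conjr (cst Dc (pull (dual_twist R))) (pull (conjr dual_twist2 (conv_map
    (@pull2 k H R) zcochain))) x y z
  = (sigma_bar sigma (x ⊗ double_mul y z) : k)%:A.
Proof.
have lml := @double_mul_linearl k H; have lmr := @double_mul_linearr k H.
have wu : pull (dual_twist R) \is a GRing.unit by apply: rmorph_unit; apply:
  dual_twist_unit.
have lin1 (z' x' : drinfeld H) :
  linear (fun y : drinfeld H =>
    (sigma_bar sigma (x' ⊗ double_mul y z') : k)%:A : R) by lin.
have lin2 (x' y' : drinfeld H) :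
  linear (fun z : drinfeld H =>
    (sigma_bar sigma (x' ⊗ double_mul y' z) : k)%:A : R) by lin.
move: x; apply: drinfeld_ext => [||p h]; [lin..|].
move: y; apply: drinfeld_ext => [||q l]; [lin|exact: lin1|].
move: z; apply: drinfeld_ext => [||r m]; [lin|exact: lin2|].
rewrite conjr_cst // pullE dprojE lfunZ.
rewrite conjr_dual_twist2E.
have lcj : linear (fun t => conjr (pull (dual_twist R)) t (q ⊗ l : drinfeld H)
  (r ⊗ m : drinfeld H)).
  by apply: linear_lfun_app; apply: linear_lfun_app; apply: linear_conjr.
rewrite (linear_scaleE _ _ lcj) (linear_tlift3 _ _ _ lcj).
rewrite double_mul_tens (linear_tlift3 (g := fun t : drinfeld H =>
  (sigma_bar sigma ((p ⊗ h : drinfeld H) ⊗ t) : k)%:A : R)); last by lin.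
under [RHS]eq_tlift3 => l1 l2 l3.
  rewrite sigma_barE (linear_tlift3 (g := fun x : k^o => (x : k)%:A : R)); last
    by lin.
  over.
rewrite exchange_tlift3.
rewrite (linear_tlift3 (g := fun x : R => _ *: x)); last by lin.
apply: eq_tlift3 => h1 h2 h3; rewrite (linear_tlift_of _ _ lcj) scaler_tlift.
transitivity (\ten_(a, b <- comul (SV h3 * h1)) \ten3_(l1, l2, l3 <- l | comul)
   ((p 1 * (q a * r (SV l3 * (b * l1))) * sigma (h2 ⊗ (l2 * m)) : k)%:A : R)).
  apply: eq_tlift => a b; rewrite conjr_dual_evalE scalerA.
  rewrite (linear_tlift3 (g := fun x : R => _ *: x)); last by lin.
  apply: eq_tlift3 => l1 l2 l3.
  by rewrite conv_mapE comulcompE cochainE !scalerA !mulrA.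
rewrite -exchange_tlift3_tlift; apply: eq_tlift3 => l1 l2 l3.
rewrite act_dual_mulE mulr_tliftr mulr_tliftl scaler_tliftl.
exact: eq_tlift.
Qed.

End EvaluationR.
End Evaluation.

(** * Transfer of the cochain identities *)

Lemma comm_mulCA (A : pzRingType) (a b c : A) :
  GRing.comm a b -> a * (b * c) = b * (a * c).
Proof. by move=> ab; rewrite !mulrA ab. Qed.

Lemma comm_rmorph (A B : pzRingType) (f : {rmorphism A -> B}) (x y : A) :
  GRing.comm x y -> GRing.comm (f x) (f y).
Proof. by move=> xy; rewrite /GRing.comm -!rmorphM xy. Qed.

Lemma conjr_transfer (k : fieldType) (C D : coalg k) (R S : falgType k)
    (f : {rmorphism conv C R -> conv D S}) (g : conv D S)
    (x y z : conv C R) (x' y' z' : conv D S) :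
  g \is a GRing.unit -> x * y * z = z * y * x ->
  x' = conjr g (f x) -> y' = conjr g (f y) -> z' = conjr g (f z) ->
  x' * y' * z' = z' * y' * x'.
Proof. by move=> gu E -> -> ->; rewrite -!conjrM // -!rmorphM E. Qed.

Lemma unit_mul (A : unitRingType) (x y : A) :
  x \is a GRing.unit -> y \is a GRing.unit -> x * y \is a GRing.unit.
Proof. by move=> xu yu; rewrite unitrMl. Qed.

Lemma conjr_absorb (A : unitRingType) (w v x : A) :
  w \is a GRing.unit -> v \is a GRing.unit -> GRing.comm v x ->
  conjr w x = conjr (w * v) x.
Proof. by move=> wu vu vx; rewrite conjr_mul // (conjr_id vu). Qed.

Section Relations.
Variables (k : fieldType) (H : hopfAlgType k).
Local Notation Hc := (hopf_coalg H).
Local Notation Dc := (double_coalg H).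

Lemma comm_pull_cst (R : falgType k) (f : conv Hc R) (r : R) :
  (forall h, GRing.comm (f h) r) -> GRing.comm (pull f) (cst Dc r).
Proof.
by move=> fr; apply/lfunP => x; rewrite mul_cst cst_mul pullE; apply: fr.
Qed.

Lemma pull2_cst (R : falgType k) (f : conv Hc R) :
  pull2 (cst Hc f) = cst Dc (pull f).
Proof.
apply/lfunP => x; apply/lfunP => y.
by rewrite pull2E !cstE !convZ pullE /= counit_dproj.
Qed.

Lemma pull2_map_cst (R : falgType k) (f : conv Hc R) :
  pull2 (conv_map (@cst k Hc R) f) = pull (conv_map (@cst k Dc R) f).
Proof.
apply/lfunP => x; apply/lfunP => y.
by rewrite pull2E pullE !conv_mapE !cstE /= counit_dproj.
Qed.

(** For f = g = W this is W ∘ (mul ⊗ id) = W23 W13. The two maps are kept apart because they differ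
    in the four-argument case. *)
Lemma comulcomp_split (R : falgType k) (f g : conv Hc R) :
  (forall x y : H, f (x * y) = f y * g x) ->
  comulcomp f = cst Hc f * conv_map (@cst k Hc R) g.
Proof.
move=> fg; apply/lfunP => x; apply/lfunP => y.
by rewrite comulcompE fg cst_mul conv_mapE mul_cst.
Qed.

Lemma pull2_comulcomp (R : falgType k) (f g : conv Hc R) :
  (forall x y : H, f (x * y) = f y * g x) ->
  pull2 (comulcomp f) = cst Dc (pull f) * pull (conv_map (@cst k Dc R) g).
Proof.
by move=> fg; rewrite (comulcomp_split fg) rmorphM /= pull2_cst pull2_map_cst.
Qed.

(** Applying the linear map [f] to the laziness identity gives exactly this commutation. *)
Lemma lazy_comm (R : falgType k) (sigma : 'Hom((H ⊗ H)%type, k^o)) (f : conv Hc R) :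
  lazy_cochain (K := hopf_ops H) sigma ->
  GRing.comm (cochain (C := Hc) sigma R) (comulcomp f).
Proof.
move=> lz; apply/lfunP => x; apply/lfunP => y; rewrite !conv2E.
have /(congr1 f) := lz x y; rewrite !linear_tlift => E.
transitivity (\ten_(x1, x2 <- comul x) f (\ten_(y1, y2 <- comul y)
      ((sigma (x1 ⊗ y1) : k) *: (x2 * y2)))).
  apply: eq_tlift => x1 x2; rewrite linear_tlift; apply: eq_tlift => y1 y2.
  by rewrite cochainE comulcompE linearZ /= mulr_algl.
rewrite [LHS]E; apply: eq_tlift => x1 x2; rewrite linear_tlift.
apply: eq_tlift => y1 y2.
by rewrite cochainE comulcompE linearZ /= mulr_algr.
Qed.

Lemma pull_dual_twist_unit (R : falgType k) : pull (dual_twist H R) \is a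
  GRing.unit.
Proof. by apply: rmorph_unit; apply: dual_twist_unit. Qed.

(** * Cochains on three arguments as conjugates by G *)

Section Level3.
Variable R : falgType k.
Local Notation R1 := (conv Dc R).

Definition twist3 : conv Dc (conv Dc R1) :=
  pull (dual_twist H R1) * pull2 (comulcomp (dual_twist H R)).

Lemma comulcomp_dual_twist_unit : pull2 (comulcomp (dual_twist H R)) \is a
  GRing.unit.
Proof. by do 2!apply: rmorph_unit; apply: dual_twist_unit. Qed.

Lemma pull_dual_twist2_unit : pull (dual_twist2 H R) \is a GRing.unit.
Proof. by apply: rmorph_unit; apply: dual_twist2_unit. Qed.

(** W12 and W23 commute, as they use the H^* and the H part of the second argument. The defining
    factorization of G suits F12 and mul ⊗ id; this one suits F23 and id ⊗ mul. *)
Lemma twist3E : twist3 = cst Dc (pull (dual_twist H R)) * pull (dual_twist2 H R).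
Proof.
have wM (x y : H) : dual_twist H R (x * y) = dual_twist H R y * dual_twist H R
  x by exact: dual_twistM.
have uE : pull (dual_twist2 H R) = pull (dual_twist H R1) * pull (conv_map
  (@cst k Dc R1) (dual_twist H R)).
  exact: (rmorphM (@pull k H _)).
have WW : GRing.comm (pull (dual_twist H R1)) (cst Dc (pull (dual_twist H R))).
  by apply: comm_pull_cst => h; rewrite dual_twistE; apply: comm_dual_eval_pull.
rewrite /twist3 (pull2_comulcomp wM) uE.
exact: comm_mulCA.
Qed.

Lemma comm_pull_dual_twist2 (f : conv Hc (conv Hc R)) :
  GRing.comm (pull (dual_twist2 H R)) (cst Dc (pull2 f)).
Proof. by apply: comm_pull_cst => h; apply: comm_dual_twist2_pull2. Qed.

Lemma twist3_unit : twist3 \is a GRing.unit.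
Proof. by apply: unit_mul; [apply: rmorph_unit; apply: dual_twist_unit | apply:
  comulcomp_dual_twist_unit]. Qed.

Variable sigma : 'Hom((H ⊗ H)%type, k^o).
Local Notation bar := (sigma_bar sigma).

Lemma twist_cochain (S : falgType k) :
  twist (cochain (C := Hc) sigma S) = cochain (C := Dc) bar S.
Proof.
by apply/lfunP => x; apply/lfunP => y; rewrite twist_cochainE cochainE.
Qed.

Lemma bar12E : lazy_cochain (K := hopf_ops H) sigma ->
  cochain (C := Dc) bar R1 = conjr twist3 (pull2 (cochain (C := Hc) sigma R1)).
Proof.
move=> lz; rewrite -twist_cochain; apply: conjr_absorb.
- exact: pull_dual_twist_unit.
- exact: comulcomp_dual_twist_unit.
- by apply: (comm_rmorph (@pull2 k H _)); apply: commr_sym; apply: lazy_comm.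
Qed.

Lemma bar23E :
  cst Dc (cochain (C := Dc) bar R) =
  conjr twist3 (cst Dc (pull2 (cochain (C := Hc) sigma R))).
Proof.
rewrite -twist_cochain twist3E [LHS](rmorph_conjr (@cst k Dc _)); last exact:
  pull_dual_twist_unit.
apply: conjr_absorb.
- by apply: rmorph_unit; apply: pull_dual_twist_unit.
- exact: pull_dual_twist2_unit.
- exact: comm_pull_dual_twist2.
Qed.

Lemma pull3_comulcomp (f : conv Hc (conv Hc R)) :
  pull3 (comulcomp f) = pull2 (comulcomp (conv_map (@pull k H R) f)).
Proof.
apply/lfunP => x; apply/lfunP => y; apply/lfunP => z.
by rewrite pull2E pull3E !comulcompE conv_mapE pullE.
Qed.

(** [comulcomp] is an algebra morphism, so it carries conjugation by W to conjugation by W ∘ (mul ⊗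
    id), the last factor of G. *)
Lemma barXE :
  twist (comulcomp (twisted_cochain sigma R)) =
  conjr twist3 (pull3 (comulcomp (cochain (C := Hc) sigma R))).
Proof.
have E : pull2 (comulcomp (twisted_cochain sigma R)) = conjr (pull2 (comulcomp
  (dual_twist H R)))
    (pull2 (comulcomp (conv_map (@pull k H R) (cochain (C := Hc) sigma R)))).
  rewrite (rmorph_conjr (@comulcomp k H _)) ?dual_twist_unit //.
  by apply: (rmorph_conjr (@pull2 k H _)); apply: rmorph_unit; apply:
    dual_twist_unit.
rewrite pull3_comulcomp (conjr_mul _ (pull_dual_twist_unit R1)
  comulcomp_dual_twist_unit) -E /twist.
reflexivity.
Qed.

Lemma barZE :
  conjr (cst Dc (pull (dual_twist H R)))
    (pull (conjr (dual_twist2 H R) (conv_map (@pull2 k H R) (zcochain sigma R)))) =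
  conjr twist3 (pull3 (zcochain sigma R)).
Proof.
have wu : cst Dc (pull (dual_twist H R)) \is a GRing.unit.
  by apply: rmorph_unit; apply: pull_dual_twist_unit.
rewrite twist3E (conjr_mul _ wu pull_dual_twist2_unit); congr (conjr _ _).
exact: (rmorph_conjr (@pull k H _) _ (dual_twist2_unit H R)).
Qed.

End Level3.

Lemma cochain_pull (R : falgType k) (sigma : 'Hom((H ⊗ H)%type, k^o)) :
  pull2 (cochain (C := Hc) sigma (conv Dc R)) =
  pull3 (cochain (C := Hc) sigma (conv Hc R)).
Proof.
apply/lfunP => x; apply/lfunP => y; apply/lfunP => z.
by rewrite pull2E pull3E !cochainE !convZ !conv1E /= counit_dproj.
Qed.

Lemma pull3_cst (R : falgType k) (f : conv Hc (conv Hc R)) :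
  pull3 (cst Hc f) = cst Dc (pull2 f).
Proof.
apply/lfunP => x; apply/lfunP => y; apply/lfunP => z.
by rewrite pull3E !cstE !convZ pull2E /= counit_dproj.
Qed.

(** * The conditions on sigma_bar *)

Section Transfer.
Variable sigma : 'Hom((H ⊗ H)%type, k^o).
Hypothesis lz : lazy_cochain (K := hopf_ops H) sigma.
Local Notation bar := (sigma_bar sigma).
Local Notation R0 := (k^o : falgType k).

Lemma neat_bar : neat (K := hopf_ops H) sigma -> neat (K := double_ops H) bar.
Proof.
move=> ns a b c.
pose F12 := pull3 (cochain (C := Hc) sigma (conv Hc R0)).
pose F23 := pull3 (cst Hc (cochain (C := Hc) sigma R0)).
have F12E : cochain (C := Dc) bar (conv Dc R0) = conjr (twist3 R0) F12.
  exact: (etrans (bar12E R0 lz) (congr1 _ (cochain_pull R0 sigma))).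
have F23E : cst Dc (cochain (C := Dc) bar R0) = conjr (twist3 R0) F23.
  exact: (etrans (bar23E R0 sigma) (congr1 _ (esym (pull3_cst _)))).
have : GRing.comm F12 F23.
  apply: (comm_rmorph (@pull3 k H _)).
  apply/lfunP => x; apply/lfunP => y; apply/lfunP => z.
  by rewrite mul_cochain_cst mul_cst_cochain; congr (_ *: _); apply: ns.
move=> /(conjr_comm (twist3_unit R0)); rewrite -F12E -F23E.
move=> /lfunP/(_ a)/lfunP/(_ b)/lfunP/(_ c).
by rewrite mul_cochain_cst mul_cst_cochain /GRing.scale /= !mulr1.
Qed.


Lemma left_cocycle_bar : left_cocycle (K := hopf_ops H) sigma ->
  left_cocycle (K := double_ops H) bar.
Proof.
move=> cs a b c.
have F12E := etrans (bar12E R0 lz) (congr1 _ (cochain_pull R0 sigma)).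
have F23E := etrans (bar23E R0 sigma) (congr1 _ (esym (pull3_cst _))).
have E : cochain (C := Hc) sigma (conv Hc R0) * comulcomp (cochain (C := Hc)
  sigma R0)
    = cst Hc (cochain (C := Hc) sigma R0) * zcochain sigma R0.
  apply/lfunP => x; apply/lfunP => y; apply/lfunP => z.
  rewrite (cochain_mul3E (C := Hc) (phi := fun x y z : H => sigma ((x * y) ⊗
    z))); last first.
    by move=> x' y' z'; rewrite comulcompE cochainE.
  rewrite (cst_cochain_mul3E (C := Hc) (phi := fun x y z : H => sigma (x ⊗ (y *
    z)))); last first.
    by move=> x' y' z'; rewrite conv_mapE comulcompE cochainE.
  by congr (_ *: _); apply: cs.
have := congr1 (fun t => conjr (twist3 R0) (pull3 t)) E.
rewrite !(rmorphM (@pull3 k H _)) !(conjrM _ _ (twist3_unit R0)).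
rewrite -F12E -F23E -barXE -barZE.
move=> /lfunP/(_ a)/lfunP/(_ b)/lfunP/(_ c) E3.
have EL := cochain_mul3E (C := Dc) (phi := fun x y z : drinfeld H =>
  bar (double_mul x y ⊗ z)) (@twist_comulcompE k H sigma R0) bar a b c.
have ER := cst_cochain_mul3E (C := Dc) (phi := fun x y z : drinfeld H =>
  bar (x ⊗ double_mul y z)) (@conjr_zcochainE k H sigma R0) bar a b c.
have := etrans (esym EL) (etrans E3 ER).
by rewrite /GRing.scale /= !mulr1.
Qed.

Lemma conv_inverse_bar (tau : 'Hom((H ⊗ H)%type, k^o)) :
  conv_inverse (K := hopf_ops H) sigma tau ->
  conv_inverse (K := double_ops H) bar (sigma_bar tau).
Proof.
move=> st.
have inv1 (s t : 'Hom((H ⊗ H)%type, k^o)) :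
    cochain (C := Hc) s R0 * cochain (C := Hc) t R0 = 1 ->
    cochain (C := Dc) (sigma_bar s) R0 * cochain (C := Dc) (sigma_bar t) R0 = 1.
  move=> E; have := congr1 (fun f => conjr (pull (dual_twist H R0)) (pull2 f)) E.
  rewrite (rmorphM (@pull2 k H _)) (conjrM _ _ (pull_dual_twist_unit R0)).
  rewrite (rmorph1 (@pull2 k H _)) [RHS](conjr_id (pull_dual_twist_unit R0));
    last exact: commr1.
  by rewrite -(twist_cochain s R0) -(twist_cochain t R0).
have E1 : cochain (C := Hc) sigma R0 * cochain (C := Hc) tau R0 = 1.
  apply/lfunP => x; apply/lfunP => y; rewrite cochain_mulE conv1E convZ conv1E.
  by rewrite scalerA; congr (_ *: _); have [-> _] := st x y.
have E2 : cochain (C := Hc) tau R0 * cochain (C := Hc) sigma R0 = 1.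
  apply/lfunP => x; apply/lfunP => y; rewrite cochain_mulE conv1E convZ conv1E.
  by rewrite scalerA; congr (_ *: _); have [_ ->] := st x y.
move=> x y; split.
  have := inv1 _ _ E1; move=> /lfunP/(_ x)/lfunP/(_ y).
  by rewrite cochain_mulE conv1E convZ conv1E /GRing.scale /= !mulr1.
have := inv1 _ _ E2; move=> /lfunP/(_ x)/lfunP/(_ y).
by rewrite cochain_mulE conv1E convZ conv1E /GRing.scale /= !mulr1.
Qed.

Lemma normalized_bar : normalized (K := hopf_ops H) sigma ->
  normalized (K := double_ops H) bar.
Proof.
move=> ns x; split; move: x; apply: drinfeld_ext => [||q l].
- by rewrite /=; lin.
- exact: double_counit_linear.
- rewrite [LHS](sigma_barE sigma (counit : dual H) q 1 l) /tlift3 comul1.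
  rewrite tlift_tens; [|lin..].
  rewrite comul1 tlift_tens; [|lin..].
  rewrite [RHS](double_counit_tens q l) counit1 antipodeV1 !mul1r.
  by have [-> _] := ns l.
- by rewrite /=; lin.
- exact: double_counit_linear.
- rewrite [LHS](sigma_barE sigma q (counit : dual H) l 1).
  rewrite [RHS](double_counit_tens q l).
  (* Evaluating the counit at S^-1(h3) h1 gives ε(h1) ε(h3), which collapses the iterated coproduct
     of [l]. *)
  transitivity (q 1 * counit (\ten_(h1, y <- comul l) ((counit (h1 : H) : k) *:
     \ten_(h2, h3 <- comul y) ((counit (h3 : H) : k) *: (h2 : H)))) : k^o).
    rewrite linear_tlift mulr_tliftr; apply: eq_tlift => h1 y.
    rewrite linearZ /= linear_tlift [X in _ * X]scaler_tlift mulr_tliftr.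
    apply: eq_tlift => h2 h3; rewrite counitM counit_antipodeV linearZ /=.
    have [_ ->] := ns h2; rewrite /GRing.scale /= -!mulrA; congr (_ * _).
    by rewrite mulrCA.
  rewrite -[in RHS](counitl l); congr (_ * counit _).
  by apply: eq_tlift => h1 y; rewrite counitr.
Qed.

(** Laziness is an equation in D; these functionals separate its points and reduce it to scalar
    equations between cochains. *)
Definition tens_eval (u : H) (a : 'Hom(H, k^o)) (x : drinfeld H) : k^o :=
  \ten_(p, h <- x) ((p : dual H) u * a h).

Lemma tens_eval_linear u a : linear (tens_eval u a).
Proof. by rewrite /tens_eval; lin. Qed.

Lemma tens_eval_tens u a (p : dual H) (h : H) :
  tens_eval u a (p ⊗ h : drinfeld H) = p u * a h.
Proof. by rewrite /tens_eval tlift_tens //; lin. Qed.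

Lemma tens_eval_inj (x y : drinfeld H) : (forall u a, tens_eval u a x =
  tens_eval u a y) -> x = y.
Proof.
pose D := \dim {:H}.
pose a (j : 'I_D) : 'Hom(H, k^o) := dual_coord j.
pose E (x : drinfeld H) : drinfeld H := \sum_(i < D) \sum_(j < D)
   (tens_eval (vbasis {:H})`_i (a j) x : k) *: (dual_coord i ⊗ (vbasis {:H})`_j).
suff EE z : E z = z.
  move=> xy; rewrite -[x]EE -[y]EE; apply: eq_bigr => i _; apply: eq_bigr => j _.
  by rewrite xy.
move: z; apply: drinfeld_ext => [c u v||p h]; [|exact: linear_id|].
  rewrite /E scaler_sumr -big_split; apply: eq_bigr => i _ /=.
  rewrite scaler_sumr -big_split; apply: eq_bigr => j _ /=.
  by rewrite tens_eval_linear scalerDl scalerA.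
have pE : p = \sum_(i < D) (p (vbasis {:H})`_i : k) *: dual_coord i.
  apply/lfunP => z; rewrite sum_lfunE [in LHS](coord_vbasis (memvf z)) linear_sum.
  apply: eq_bigr => i _; rewrite scale_lfunE dual_coordE linearZ /=.
  by rewrite /GRing.scale /= mulrC.
rewrite [in RHS]pE.
transitivity (\sum_(i < D) (p (vbasis {:H})`_i : k) *: (dual_coord i ⊗ h :
  drinfeld H)).
  apply: eq_bigr => i _.
  transitivity (\sum_(j < D) (p (vbasis {:H})`_i : k) *:
     (((a j) h : k) *: (dual_coord i ⊗ (vbasis {:H})`_j) : drinfeld H)).
    by apply: eq_bigr => j _; rewrite tens_eval_tens scalerA.
  rewrite -scaler_sumr; congr (_ *: _).
  apply: (sum_dual_coord (g := fun z => (dual_coord i ⊗ z : drinfeld H)));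
    exact: tensDr.
pose T : {linear dual H -> drinfeld H} := HB.pack (fun q : dual H => (q ⊗ h :
  drinfeld H))
  (GRing.isLinear.Build _ _ _ _ _ (tensDl h)).
rewrite -[RHS]/(T _) linear_sum; apply: eq_bigr => i _.
by rewrite linearZ.
Qed.

(* The composite of [tens_eval u a] with the product of D, written so that it
   visibly commutes with sigma_bar. *)
Definition dcomul (u : H) (a : 'Hom(H, k^o)) : conv Dc (conv Dc R0) :=
  \ten_(u1, u2 <- comul u) (dual_eval (conv Dc R0) u1 *
    conjr (pull (dual_twist H R0))
       (cst Dc (dual_eval R0 u2) * pull2 (comulcomp (a : conv Hc R0)))).

(** Both sides are p(u1) q(S^-1(h3) u2 h1) a(h2 l); conjugation by W supplies the S^-1(h3) and h1
    around u2. *)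
Lemma dcomulE u a (x y : drinfeld H) : dcomul u a x y = tens_eval u a
  (double_mul x y).
Proof.
have lml := @double_mul_linearl k H; have lmr := @double_mul_linearr k H.
have ld := tens_eval_linear u a.
move: x; apply: drinfeld_ext => [||p h]; [lin|exact: (linear_comp ld)|].
move: y; apply: drinfeld_ext => [||q l]; [lin|exact: (linear_comp ld)|].
rewrite double_mul_tens (linear_tlift3 _ _ _ ld) /dcomul !tlift_app.
under [RHS]eq_tlift3 => h1 h2 h3 do rewrite tens_eval_tens act_dual_mulE
  mulr_tliftl.
rewrite exchange_tlift3_tlift; apply: eq_tlift => u1 u2.
rewrite -pull_cst -(rmorphM (@pull k H _)).
rewrite -(rmorph_conjr (@pull k H _) _ (dual_twist_unit H R0)) dual_eval_pull
  convZ conjr_dual_twistE.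
rewrite (linear_tlift3 (g := fun x : R0 => (p u1 : k) *: x)); last by lin.
apply: eq_tlift3 => h1 h2 h3; rewrite comulcompE.
by rewrite /GRing.scale /= mulrA.
Qed.

(** sigma_bar commutes with the outer [dual_eval], which uses the H^* part of the first argument.
    Once the conjugation by W is removed, F commutes with [dual_eval R0 u2] by separation and with a
    ∘ mul by laziness. *)
Lemma comm_bar_dcomul u a :
  GRing.comm (cochain (C := Dc) bar R0) (dcomul u a).
Proof.
rewrite /GRing.comm mulr_tliftl mulr_tliftr; apply: eq_tlift => u1 u2.
rewrite -(twist_cochain sigma R0).
apply: commrM.
  by apply: commr_sym; rewrite twist_pull; apply: comm_dual_eval_pull.
apply: (conjr_comm (pull_dual_twist_unit R0)); apply: commrM.
  apply: comm_pull_cst => h; apply: commr_sym; rewrite conv_mapE.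
  exact: comm_dual_eval_pull.
by apply: (comm_rmorph (@pull2 k H _)); apply: lazy_comm.
Qed.

Lemma lazy_bar : lazy_cochain (K := double_ops H) bar.
Proof.
move=> x y; apply: tens_eval_inj => u a.
have ld := tens_eval_linear u a.
have := comm_bar_dcomul u a => /lfunP/(_ x)/lfunP/(_ y).
rewrite !conv2E => E.
rewrite !(linear_tlift_of _ _ ld).
transitivity (\ten_(x1, x2 <- double_comul x) \ten_(y1, y2 <- double_comul y)
  (cochain (C := Dc) bar R0 x1 y1 * dcomul u a x2 y2)).
  apply: eq_tlift => x1 x2; rewrite (linear_tlift_of _ _ ld); apply: eq_tlift
    => y1 y2.
  by rewrite (linear_scaleE _ _ ld) cochainE dcomulE mulr_algl.
rewrite [LHS]E.
apply: eq_tlift => x1 x2; rewrite (linear_tlift_of _ _ ld); apply: eq_tlift =>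
  y1 y2.
by rewrite (linear_scaleE _ _ ld) cochainE dcomulE mulr_algr.
Qed.


(** * Purity: cochains on four arguments *)

Section Pure.
Local Notation A3 := (conv Dc R0).

(* [pull dual_twist234] and [pull dual_twist14] are W34 W24, on the last three
   arguments, and W14. *)
Definition dual_twist234 : conv Hc (conv Dc A3) :=
  conv_map (@pull k H A3) (comulcomp (dual_twist H R0)).

Definition dual_twist14 : conv Hc (conv Dc (conv Dc A3)) :=
  conv_map (@cst k Dc (conv Dc A3)) (conv_map (@cst k Dc A3) (dual_twist H R0)).

Lemma dual_twist14_unit : pull dual_twist14 \is a GRing.unit.
Proof. by do 3!apply: rmorph_unit; apply: dual_twist_unit. Qed.

Lemma dual_twist234_unit : cst Dc (pull dual_twist234) \is a GRing.unit.
Proof. by do 4!apply: rmorph_unit; apply: dual_twist_unit. Qed.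

(** Both sides are W(xyz, t), with x, y, z projected to H: antimultiplicativity splits it into W34
    W24 and W14. *)
Lemma comulcomp_dual_twist234 :
  pull2 (comulcomp dual_twist234) = cst Dc (pull dual_twist234) * pull dual_twist14.
Proof.
apply: pull2_comulcomp => x y; apply/lfunP => z.
rewrite !conv_mapE mul_cst !pullE !comulcompE -mulrA.
exact: dual_twistM.
Qed.

Lemma comm_dual_twist14_cst (f : conv Hc (conv Hc A3)) :
  (forall u x y, GRing.comm (dual_eval R0 u) (f x y)) ->
  GRing.comm (pull dual_twist14) (cst Dc (pull2 f)).
Proof.
move=> cf; apply: comm_pull_cst => h; rewrite !conv_mapE.
apply/lfunP => x; rewrite cst_mul mul_cst; apply/lfunP => y.
by rewrite cst_mul mul_cst pull2E dual_twistE; apply: cf.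
Qed.

(** Used with w = W23, u = W12 W13, n = W34 W24, m = W14 and z the cochain of id ⊗ mul on arguments
    2, 3, 4, whose natural conjugating element is w n; u and m can be inserted freely. *)
Lemma conjr_quad (A : unitRingType) (w u n m z : A) :
  w \is a GRing.unit -> u \is a GRing.unit -> n \is a GRing.unit ->
  m \is a GRing.unit -> GRing.comm m z -> GRing.comm u n -> GRing.comm u z ->
  conjr (w * n) z = conjr (w * u * (n * m)) z.
Proof.
move=> wu uu nu mu mz un uz; have nmu := unit_mul nu mu.
rewrite (conjr_mul _ (unit_mul wu uu) nmu) -(conjr_absorb nu mu mz).
rewrite !conjr_mul // [conjr u _]conjr_id //.
apply: commrM; first exact: commrM.
by apply: commrV.
Qed.

Definition pull4 (f : conv Hc (conv Hc (conv Hc (conv Hc R0)))) :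
  conv Dc (conv Dc (conv Dc A3)) := pull (conv_map (@pull3 k H R0) f).

HB.instance Definition _ := GRing.LRMorphism.copy pull4
  (@pull k H _ \o conv_map (@pull3 k H R0)).

Lemma pull4E f (x y z t : drinfeld H) :
  pull4 f x y z t = f (dproj H x) (dproj H y) (dproj H z) (dproj H t).
Proof. by rewrite /pull4 pullE conv_mapE pull3E. Qed.

Lemma pull4_comulcomp (s : 'Hom((H ⊗ H)%type, k^o)) :
  pull3 (comulcomp (cochain (C := Hc) s A3)) =
  pull4 (comulcomp (cochain (C := Hc) s (conv Hc R0))).
Proof.
apply/lfunP => x; apply/lfunP => y; apply/lfunP => z; apply/lfunP => t.
rewrite pull4E pull3E !comulcompE !cochainE !convZ !conv1E.
by rewrite /= counit_dproj.
Qed.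

Lemma pull4_cst_cochain (s : 'Hom((H ⊗ H)%type, k^o)) :
  cst Dc (pull2 (cochain (C := Hc) s A3)) =
  pull4 (cst Hc (cochain (C := Hc) s (conv Hc R0))).
Proof.
apply/lfunP => x; apply/lfunP => y; apply/lfunP => z; apply/lfunP => t.
rewrite pull4E !cstE !convZ pull2E !cochainE !convZ !conv1E.
by rewrite /= !counit_dproj.
Qed.

Lemma pull4_cst (f : conv Hc (conv Hc (conv Hc R0))) :
  cst Dc (pull3 f) = pull4 (cst Hc f).
Proof.
apply/lfunP => x; apply/lfunP => y; apply/lfunP => z; apply/lfunP => t.
by rewrite pull4E !cstE !convZ pull3E /= counit_dproj.
Qed.

Section PureBar.
Variable tau : 'Hom((H ⊗ H)%type, k^o).
Hypothesis st : conv_inverse (K := hopf_ops H) sigma tau.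
Local Notation Q := (pull2 (comulcomp dual_twist234)).
Local Notation G := (twist3 A3 * Q).
Local Notation X := (pull3 (comulcomp (cochain (C := Hc) sigma A3))).
Local Notation F := (cst Dc (pull2 (cochain (C := Hc) sigma A3))).
Local Notation T := (cst Dc (pull2 (cochain (C := Hc) tau A3))).
Local Notation Z := (cst Dc (pull3 (zcochain sigma R0))).

Lemma Q_unit : Q \is a GRing.unit.
Proof. by do 4!apply: rmorph_unit; apply: dual_twist_unit. Qed.

Lemma G_unit : G \is a GRing.unit.
Proof. exact: unit_mul (twist3_unit A3) Q_unit. Qed.

(** Both factors depend on the first two arguments through their product in H; with these merged,
    the claim is laziness. *)
Lemma comm_Q_X : GRing.comm Q X.
Proof.
rewrite pull3_comulcomp; apply: (comm_rmorph (@pull2 k H _)).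
apply: (comm_rmorph (@comulcomp k H _)).
apply: (comm_rmorph (conv_map (@pull k H A3))).
by apply: commr_sym; apply: lazy_comm.
Qed.

(** [F] lives on arguments 2 and 3: it commutes with W34 W24 by laziness and with W14 because the
    arguments are disjoint. *)
Lemma comm_Q_F : GRing.comm Q F.
Proof.
rewrite comulcomp_dual_twist234; apply: commr_sym; apply: commrM.
  apply: (comm_rmorph (@cst k Dc _)); apply: (comm_rmorph (@pull2 k H _)).
  exact: lazy_comm.
apply: commr_sym; apply: comm_dual_twist14_cst => u x y; rewrite cochainE.
by rewrite /GRing.comm mulr_algl mulr_algr.
Qed.

(** Lets the commutation with [Q] pass from [F] to [T] by [commrV]. *)
Lemma T_inverse : F^-1 = T.
Proof.
have FT (s t : 'Hom((H ⊗ H)%type, k^o)) :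
    (forall x y : H, \ten_(x1, x2 <- comul x) \ten_(y1, y2 <- comul y)
      (s (x1 ⊗ y1) * t (x2 ⊗ y2)) = counit x * counit y) ->
    cst Dc (pull2 (cochain (C := Hc) s A3)) *
    cst Dc (pull2 (cochain (C := Hc) t A3)) = 1.
  move=> E; rewrite -(rmorphM (@cst k Dc _)) -(rmorphM (@pull2 k H _)).
  rewrite (_ : cochain (C := Hc) s A3 * cochain (C := Hc) t A3 = 1).
    by rewrite (rmorph1 (@pull2 k H _)) (rmorph1 (@cst k Dc _)).
  apply/lfunP => x; apply/lfunP => y; rewrite cochain_mulE conv1E convZ conv1E.
  by rewrite scalerA; congr (_ *: _); apply: E.
have [//||_ ->//] := @inverse_unit _ F T.
  by apply: FT => x y; have [-> _] := st x y.
by apply: FT => x y; have [_ ->] := st x y.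
Qed.

Lemma barX4 : twist (comulcomp (twisted_cochain sigma A3)) = conjr G X.
Proof.
rewrite (conjr_mul _ (twist3_unit A3) Q_unit) (conjr_id Q_unit comm_Q_X).
exact: barXE.
Qed.

Lemma barT4 : cst Dc (cochain (C := Dc) (sigma_bar tau) A3) = conjr G T.
Proof.
have QT : GRing.comm Q T by rewrite -T_inverse; apply: commrV; apply: comm_Q_F.
rewrite (conjr_mul _ (twist3_unit A3) Q_unit) (conjr_id Q_unit QT).
exact: bar23E.
Qed.

Lemma barZ4 :
  cst Dc (conjr (cst Dc (pull (dual_twist H R0)))
    (pull (conjr (dual_twist2 H R0) (conv_map (@pull2 k H R0) (zcochain sigma
      R0))))) =
  conjr G Z.
Proof.
(* The last argument is pulled back beforehand, which gives the [pull2] shape required by the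
   commutation lemmas. *)
have zE : pull3 (zcochain sigma R0) =
    pull2 (conv_map (conv_map (@pull k H R0)) (zcochain sigma R0)).
  apply/lfunP => x; apply/lfunP => y; apply/lfunP => z.
  by rewrite pull3E pull2E !conv_mapE pullE.
rewrite barZE (rmorph_conjr (@cst k Dc _) _ (twist3_unit R0)).
rewrite (twist3E A3) comulcomp_dual_twist234 (rmorphM (@cst k Dc _)).
apply: conjr_quad.
- by apply: rmorph_unit; apply: pull_dual_twist_unit.
- exact: pull_dual_twist2_unit.
- exact: dual_twist234_unit.
- exact: dual_twist14_unit.
- rewrite zE; apply: comm_dual_twist14_cst => u x y; rewrite !conv_mapE.
  exact: comm_dual_eval_pull.
- exact: comm_pull_dual_twist2.
- by rewrite zE; apply: comm_pull_dual_twist2.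
Qed.

End PureBar.

Lemma pure_bar : pure (K := hopf_ops H) sigma -> pure (K := double_ops H) bar.
Proof.
move=> [tau st ps]; exists (sigma_bar tau); first exact: conv_inverse_bar.
move=> a b c d.
pose Xh := comulcomp (cochain (C := Hc) sigma (conv Hc R0)).
pose Th := cst Hc (cochain (C := Hc) tau (conv Hc R0)).
pose Zh := cst Hc (zcochain sigma R0).
have XhE (x y z : H) : Xh x y z = (sigma ((x * y) ⊗ z) : k)%:A.
  by rewrite comulcompE cochainE.
have zE (x y z : H) : zcochain sigma R0 x y z = (sigma (x ⊗ (y * z)) : k)%:A.
  by rewrite conv_mapE comulcompE cochainE.
have E : Xh * Th * Zh = Zh * Th * Xh.
  apply/(pure_commE (C := Hc) (phi := fun x y z : H => sigma ((x * y) ⊗ z))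
    (psi := fun x y z : H => sigma (x ⊗ (y * z))) XhE zE tau).
  exact: ps.
have XE := etrans barX4 (congr1 (conjr _) (pull4_comulcomp sigma)).
have TE := etrans (barT4 st) (congr1 (conjr _) (pull4_cst_cochain tau)).
have ZE := etrans barZ4 (congr1 (conjr _) (pull4_cst (zcochain sigma R0))).
have E' := conjr_transfer G_unit E XE TE ZE.
have E2 := (pure_commE (C := Dc) (phi := fun x y z : drinfeld H =>
    bar (double_mul x y ⊗ z)) (psi := fun x y z : drinfeld H =>
    bar (x ⊗ double_mul y z)) (@twist_comulcompE k H sigma A3)
      (@conjr_zcochainE k H sigma R0)
  (sigma_bar tau)).
exact: (E2.1 E').
Qed.

End Pure.

End Transfer.
End Relations.

Theorem proposition4p1 (k : fieldType) (H : hopfAlgType k)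
  (sigma : 'Hom((H ⊗ H)%type, k^o)) (hsigma : Z2L (K := hopf_ops H) sigma) :
  (Z2PL (K := hopf_ops H) sigma ->
     Z2PL (K := double_ops H) (sigma_bar sigma)) /\
  (Z2NL (K := hopf_ops H) sigma ->
     Z2NL (K := double_ops H) (sigma_bar sigma)).
Proof.
have [[[tau st] ns] lz cs] := hsigma.
have barL : Z2L (K := double_ops H) (sigma_bar sigma).
  split; [split|exact: lazy_bar|exact: left_cocycle_bar].
    by exists (sigma_bar tau); apply: conv_inverse_bar.
  exact: normalized_bar.
by split=> -[_ h]; split=> //; [apply: pure_bar | apply: neat_bar].
Qed.
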